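(* For any $\varphi\in\mathrm{Exp}$, the $\mathfrak{g}$-module $\mathbf{L}(\varphi)$ is (isomorphic to) an irreducible subquotient of $\mathbf{M}(0)$. Moreover, if $\mathbb{k}$ is algebraically closed, then any irreducible subquotient of $\mathbf{M}(0)$ is isomorphic to $\mathbf{L}(\varphi)$ for some $\varphi\in\mathrm{Exp}$.
   Context: Let $\mathbb{k}$ be a field of characteristic zero. Let $\mathrm{sl}(2)$ be the Lie algebra over $\mathbb{k}$ with basis $e,f,h$ and $[e,f]=h$, $[h,e]=2e$, $[h,f]=-2f$. Let $\mathfrak{g}=\mathrm{sl}(2)\otimes\mathbb{k}[t^{\pm1}]$ be the loop algebra, with $x(k)=x\otimes t^k$ and $[x(k),y(l)]=[x,y](k+l)$, $\mathbb{Z}$-graded by degree in $t$. Put $\mathcal{E}=\bigoplus_{j\in\mathbb{Z}}\mathbb{k}e(j)$, $\mathcal{H}=\bigoplus_{j\in\mathbb{Z}}\mathbb{k}h(j)$, $\mathcal{F}=\bigoplus_{j\in\mathbb{Z}}\mathbb{k}f(j)$. Let $\mathbf{M}(0)=\mathrm{Ind}_{\mathcal{H}\oplus\mathcal{E}}^{\mathfrak{g}}\,\mathbb{k}u_0$ be the $\mathfrak{g}$-module induced from the one-dimensional module $\mathbb{k}u_0$ with $(\mathcal{H}\oplus\mathcal{E})\cdot u_0=0$, graded with $u_0$ in degree $0$. All modules carry a $\mathbb{Z}$-grading compatible with that of the acting algebra; submodules and (sub)quotients are graded, and a non-zero module is irreducible if it has no proper non-zero graded submodule. Isomorphisms are isomorphisms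 of modules, disregarding an overall shift of the grading. A subquotient of a module $M$ is a module isomorphic to $N/P$ for submodules $M\supset N\supset P$. For a function $\varphi:\mathbb{Z}\to\mathbb{k}$, let $\tilde\varphi:U(\mathcal{H})\to\mathbb{k}[t^{\pm1}]$ be the homomorphism of graded algebras with $\tilde\varphi(h(k))=\varphi(k)t^k$, $k\in\mathbb{Z}$; $\mathbf{W}(\varphi)$ denotes the image of $\tilde\varphi$, considered as a graded $\mathcal{H}$-module via $\tilde\varphi$. For an $\mathcal{H}$-module $\Lambda$ on which $h(0)$ acts by a scalar, $\mathbf{V}(\Lambda)=\mathrm{Ind}_{\mathcal{H}\oplus\mathcal{E}}^{\mathfrak{g}}\Lambda$, where $\mathcal{E}\cdot\Lambda=0$; it has a unique maximal submodule among those having trivial intersection with $\Lambda$, and $\mathbf{L}(\Lambda)$ denotes the quotient of $\mathbf{V}(\Lambda)$ by it. Write $\mathbf{L}(\varphi)=\mathbf{L}(\mathbf{W}(\varphi))$. For $n\geq0$, $\mathrm{Exp}_n$ is the set of all functions $\varphi:\mathbb{Z}\to\mathbb{k}$ of the form $\varphi(k)=-2\sum_{i=1}^n\alpha_i^k$, $k\in\mathbb{Z}$, for some non-zero $\alpha_1,\dots,\alpha_n\in\mathbb{k}$ (so $\mathrm{Exp}_0=\{0\}$), and $\mathrm{Exp}=\bigcup_{n\geq0}\mathrm{Exp}_n$. *)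

(* Defs.v *)
(* Graded modules over the loop algebra g of sl(2), with basis x(n), x in
   {e, f, h}, n in Z, and brackets [x(m), y(n)] = [x, y](m + n). H and E denote
   the spans of the h(n) and of the e(n). *)
From HB Require Import structures.
From mathcomp Require Import all_boot all_order all_algebra.
From mathcomp Require Import boolp.

Set Implicit Arguments.
Unset Strict Implicit.
Unset Printing Implicit Defensive.

Import GRing.Theory.
Local Open Scope ring_scope.
Local Open Scope quotient_scope.

(* The quotient of a type by a congruence for vector space operations that
   satisfy the vector space axioms up to that congruence. *)
Record preVect (k : fieldType) := PreVect {
  pcar :> Type;
  peq : pcar -> pcar -> Prop;
  pzero : pcar;
  padd : pcar -> pcar -> pcar;
  pscale : k -> pcar -> pcar;
  peq_refl : forall x, peq x x;
  peq_sym : forall x y, peq x y -> peq y x;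
  peq_trans : forall x y z, peq x y -> peq y z -> peq x z;
  peq_add : forall x x' y y', peq x x' -> peq y y' -> peq (padd x y) (padd x' y');
  peq_scale : forall a x x', peq x x' -> peq (pscale a x) (pscale a x');
  paddA : forall x y z, peq (padd x (padd y z)) (padd (padd x y) z);
  paddC : forall x y, peq (padd x y) (padd y x);
  padd0 : forall x, peq (padd pzero x) x;
  paddN : forall x, peq (padd (pscale (-1) x) x) pzero;
  pscaleA : forall a b x, peq (pscale a (pscale b x)) (pscale (a * b) x);
  pscale1 : forall x, peq (pscale 1 x) x;
  pscaleDr : forall a x y, peq (pscale a (padd x y)) (padd (pscale a x) (pscale a y));
  pscaleDl : forall a b x, peq (pscale (a + b) x) (padd (pscale a x) (pscale b x)) }.

Section PreQuot.
Variables (k : fieldType) (P : preVect k).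

Definition prel : rel {classic P} := fun x y => `[< peq (x : P) (y : P) >].

Lemma prel_equiv : equiv_class_of prel.
Proof.
split.
- by move=> x; apply/asboolP/peq_refl.
- by move=> x y; apply/asboolP/asboolP => /peq_sym.
- move=> y x z /asboolP xy /asboolP yz; apply/asboolP; exact: peq_trans xy yz.
Qed.
Canonical prel_equivRel := EquivRelPack prel_equiv.

Definition pquot := {eq_quot prel}.
HB.instance Definition _ := Choice.on pquot.

Definition ppi (x : P) : pquot := \pi_({eq_quot prel}) (x : {classic P}).
Definition prepr (q : pquot) : P := repr (q : {eq_quot prel}).

Lemma preprK q : ppi (prepr q) = q. Proof. exact: reprK. Qed.

Lemma ppi_eq (x y : P) : ppi x = ppi y <-> peq x y.
Proof.
split; first by move/eqmodP => /asboolP.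
by move=> h; apply/eqmodP/asboolP.
Qed.

Lemma prepr_pi (x : P) : peq (prepr (ppi x)) x.
Proof. by apply/ppi_eq; rewrite preprK. Qed.

Definition pqadd (x y : pquot) := ppi (padd (prepr x) (prepr y)).
Definition pqscale (a : k) (x : pquot) := ppi (pscale a (prepr x)).
Definition pqopp (x : pquot) := pqscale (-1) x.

Lemma ppi_addE (x y : P) : pqadd (ppi x) (ppi y) = ppi (padd x y).
Proof. by apply/ppi_eq/peq_add; apply: prepr_pi. Qed.
Lemma ppi_scaleE a (x : P) : pqscale a (ppi x) = ppi (pscale a x).
Proof. by apply/ppi_eq/peq_scale/prepr_pi. Qed.

Fact pqaddA : associative pqadd.
Proof.
move=> x y z; rewrite -(preprK x) -(preprK y) -(preprK z) !ppi_addE.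
exact/ppi_eq/paddA.
Qed.
Fact pqaddC : commutative pqadd.
Proof.
move=> x y; rewrite -(preprK x) -(preprK y) !ppi_addE; exact/ppi_eq/paddC.
Qed.
Fact pqadd0 : left_id (ppi (pzero P)) pqadd.
Proof. move=> x; rewrite -(preprK x) ppi_addE; exact/ppi_eq/padd0. Qed.
Fact pqaddN : left_inverse (ppi (pzero P)) pqopp pqadd.
Proof.
move=> x; rewrite -(preprK x) /pqopp ppi_scaleE ppi_addE.
exact/ppi_eq/paddN.
Qed.
HB.instance Definition _ := GRing.isZmodule.Build pquot
  pqaddA pqaddC pqadd0 pqaddN.

Lemma ppiD (x y : P) : ppi (padd x y) = ppi x + ppi y.
Proof. exact/esym/ppi_addE. Qed.

Fact pqscaleA a b (x : pquot) : pqscale a (pqscale b x) = pqscale (a * b) x.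
Proof. rewrite -(preprK x) !ppi_scaleE; exact/ppi_eq/pscaleA. Qed.
Fact pqscale1 : left_id 1 pqscale.
Proof. move=> x; rewrite -(preprK x) ppi_scaleE; exact/ppi_eq/pscale1. Qed.
Fact pqscaleDr : right_distributive pqscale +%R.
Proof.
move=> a x y; rewrite -(preprK x) -(preprK y) -ppiD !ppi_scaleE -ppiD.
exact/ppi_eq/pscaleDr.
Qed.
Fact pqscaleDl (x : pquot) : {morph pqscale^~ x : a b / a + b}.
Proof.
move=> a b; rewrite -(preprK x) !ppi_scaleE -ppiD; exact/ppi_eq/pscaleDl.
Qed.
HB.instance Definition _ := GRing.Zmodule_isLmodule.Build k pquot
  pqscaleA pqscale1 pqscaleDr pqscaleDl.

Lemma ppiZ a (x : P) : ppi (pscale a x) = a *: ppi x.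
Proof. exact/esym/ppi_scaleE. Qed.
Lemma ppi0 : ppi (pzero P) = 0. Proof. by []. Qed.

End PreQuot.

(* The basis of sl(2), and the brackets of basis elements: every [x, y] is an
   integer multiple n *: z of a basis element z, recorded as (n, z). *)
Inductive sl2 : Type := E | H | F.

Definition br (x y : sl2) : int * sl2 :=
  match x, y with
  | E, F => (1, H)   | F, E => (-1, H)
  | H, E => (2, E)   | E, H => (-2, E)
  | H, F => (-2, F)  | F, H => (2, F)
  | E, E | H, H | F, F => (0, H)
  end%Z.

(* A Z-graded vector space is the family V of its homogeneous components.
   Since x(n) has degree n, exactly one x(n) maps V_i to V_j, namely the one
   with n = j - i; [act x j v] is x(j - i) applied to v in V_i. In particular
   x(n) acts on V_i as [act x (i + n)]. Indexing by source and
   target rather than by n avoids all transports along equations in int. *)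

(* A g-module is given by the action of the basis x(n) of g. *)
Record gmod (k : fieldType) := GMod {
  gcar :> int -> lmodType k;
  act : sl2 -> forall i j, gcar i -> gcar j;
  act_lin : forall x i j, linear (act x j : gcar i -> gcar j);
  (* x(l - j) y(j - i) - y(j - i) x(l - j) = [x, y](l - i) on V_i *)
  act_br : forall x y i j l (v : gcar i),
    act x l (act y j v) - act y l (act x (i + (l - j)) v)
      = (br x y).1%:~R *: act (br x y).2 l v }.

(* H-modules: [hact j v] is h(j - i) v for v in V_i, and H is abelian. *)
Record hmod (k : fieldType) := HMod {
  hcar :> int -> lmodType k;
  hact : forall i j, hcar i -> hcar j;
  hact_lin : forall i j, linear (hact j : hcar i -> hcar j);
  hact_comm : forall i j l (v : hcar i),
    hact l (hact j v) = hact l (hact (i + (l - j)) v) }.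

Section Gmod.
Variable k : fieldType.

Record submod (M : gmod k) := SubMod {
  smem :> forall i, M i -> Prop;
  smem0 : forall i, smem (0 : M i);
  smemD : forall i (u v : M i), smem u -> smem v -> smem (u + v);
  smemZ : forall i a (v : M i), smem v -> smem (a *: v);
  smem_act : forall x i j (v : M i), smem v -> smem (act x j v) }.

Definition sub_le (M : gmod k) (P N : submod M) : Prop :=
  forall i (v : M i), P i v -> N i v.

Definition fullsub (M : gmod k) : submod M.
Proof. by exists (fun _ _ => True). Defined.

Section Subquot.
Variables (M : gmod k) (N P : submod M).

Definition subquot_pre (i : int) : preVect k.
Proof.
pose T := {v : M i | N i v}.
pose z : T := exist _ 0 (smem0 N i).
pose a (u v : T) : T :=
  exist _ (sval u + sval v) (smemD (svalP u) (svalP v)).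
pose s (c : k) (u : T) : T := exist _ (c *: sval u) (smemZ c (svalP u)).
refine (@PreVect k T (fun u v => P i (sval u - sval v)) z a s
  _ _ _ _ _ _ _ _ _ _ _ _ _) => /=.
- by move=> x; rewrite subrr; apply: smem0.
- by move=> x y h; rewrite -opprB -scaleN1r; apply: smemZ.
- move=> x y t h1 h2; rewrite -(subrK (sval y) (sval x)) -addrA.
  exact: smemD.
- by move=> x x' y y' h1 h2; rewrite opprD addrACA; apply: smemD.
- by move=> c x x' h; rewrite -scalerBr; apply: smemZ.
- by move=> x y t; rewrite addrA subrr; apply: smem0.
- by move=> x y; rewrite [sval x + _]addrC subrr; apply: smem0.
- by move=> x; rewrite add0r subrr; apply: smem0.
- by move=> x; rewrite scaleN1r addNr subrr; apply: smem0.
- by move=> c d x; rewrite scalerA subrr; apply: smem0.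
- by move=> x; rewrite scale1r subrr; apply: smem0.
- by move=> c x y; rewrite scalerDr subrr; apply: smem0.
- by move=> c d x; rewrite scalerDl subrr; apply: smem0.
Defined.

Definition subquot_car (i : int) : lmodType k := pquot (subquot_pre i).

Definition subquot_pi i (v : M i) (Nv : N i v) : subquot_car i :=
  ppi (exist _ v Nv : subquot_pre i).

Lemma subquot_pi_eq i (u v : M i) (Nu : N i u) (Nv : N i v) :
  subquot_pi Nu = subquot_pi Nv <-> P i (u - v).
Proof. exact: ppi_eq. Qed.

Lemma subquot_piP i (q : subquot_car i) :
  exists (v : M i) (Nv : N i v), q = subquot_pi Nv.
Proof.
rewrite -(preprK q); case: (prepr q) => v Nv.
by exists v, Nv.
Qed.

Lemma subquot_pi_lin i a (u v : M i) (Nu : N i u) (Nv : N i v) Nw :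
  subquot_pi (v := a *: u + v) Nw = a *: subquot_pi Nu + subquot_pi Nv.
Proof.
rewrite /subquot_pi -ppiZ -ppiD; apply/ppi_eq => /=.
by rewrite subrr; apply: smem0.
Qed.

Definition subquot_act (x : sl2) (i j : int) (q : subquot_car i) :
  subquot_car j :=
  subquot_pi (smem_act x j (svalP (prepr q))).

Lemma act_linear_sub x i j (u v : M i) :
  act x j u - act x j v = act x j (u - v).
Proof.
by rewrite addrC -scaleN1r -act_lin scaleN1r addrC.
Qed.

Lemma subquot_actE x i j (v : M i) (Nv : N i v) (Nw : N j (act x j v)) :
  subquot_act x j (subquot_pi Nv) = subquot_pi Nw.
Proof.
apply/subquot_pi_eq; rewrite act_linear_sub; apply: smem_act.
exact: (prepr_pi (exist _ v Nv : subquot_pre i)).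
Qed.

Fact subquot_act_lin x i j : linear (@subquot_act x i j).
Proof.
move=> a p q.
have [u [Nu ->]] := subquot_piP p; have [v [Nv ->]] := subquot_piP q.
have Nw : N i (a *: u + v) by apply: smemD => //; apply: smemZ.
rewrite -(subquot_pi_lin Nu Nv Nw).
have Nxu := smem_act x j Nu; have Nxv := smem_act x j Nv.
have Nxw := smem_act x j Nw.
rewrite (subquot_actE Nu Nxu) (subquot_actE Nv Nxv) (subquot_actE Nw Nxw).
have Nxw' : N j (a *: act x j u + act x j v)
  by apply: smemD => //; apply: smemZ.
rewrite -(subquot_pi_lin Nxu Nxv Nxw'); apply/subquot_pi_eq.
by rewrite act_lin subrr; apply: smem0.
Qed.

Fact subquot_act_br x y i j l (q : subquot_car i) :
  subquot_act x l (subquot_act y j q)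
    - subquot_act y l (subquot_act x (i + (l - j)) q)
  = (br x y).1%:~R *: subquot_act (br x y).2 l q.
Proof.
have [v [Nv ->]] := subquot_piP q.
have N1 := smem_act y j Nv; have N2 := smem_act x l N1.
have N3 := smem_act x (i + (l - j)) Nv; have N4 := smem_act y l N3.
have N5 := smem_act (br x y).2 l Nv.
rewrite (subquot_actE Nv N1) (subquot_actE N1 N2) (subquot_actE Nv N3).
rewrite (subquot_actE N3 N4) (subquot_actE Nv N5).
rewrite addrC -scaleN1r.
have N6 : N l (-1 *: act y l (act x (i + (l - j)) v) + act x l (act y j v))
  by apply: smemD => //; apply: smemZ.
rewrite -(subquot_pi_lin N4 N2 N6) -[RHS]addr0.
have <- : subquot_pi (smem0 N l) = 0 by [].
have N7 : N l ((br x y).1%:~R *: act (br x y).2 l v + 0)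
  by apply: smemD; [apply: smemZ | apply: smem0].
rewrite -(subquot_pi_lin N5 _ N7); apply/subquot_pi_eq.
rewrite addr0 -(@act_br _ M x y i j l v) scaleN1r [- _ + _]addrC subrr.
exact: smem0.
Qed.

(* N/P; meaningful when P is contained in N *)
Definition subquot : gmod k :=
  @GMod k subquot_car subquot_act subquot_act_lin subquot_act_br.

End Subquot.

(* The overall shift of the grading is the degree d of the isomorphism. *)
Definition iso (M M' : gmod k) : Prop :=
  exists (d : int) (f : forall i, M i -> M' (i + d)),
    [/\ forall i, linear (f i),
        forall i, bijective (f i) &
        forall x i j (v : M i), f j (act x j v) = act x (j + d) (f i v)].

Definition irreducible (M : gmod k) : Prop :=
  (exists i (v : M i), v <> 0) /\
  (forall N : submod M,
     (forall i (v : M i), N i v -> v = 0) \/ (forall i (v : M i), N i v)).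

Definition subquotient (S M : gmod k) : Prop :=
  exists N P : submod M, sub_le P N /\ iso S (subquot N P).

End Gmod.

(* The induced module V(Lam), with E.Lam = 0, presented by generators and
   relations as a g-module: [vterm] are the formal expressions built from
   elements of Lam with the operators x(n) and the vector space operations, and
   [veq] is the congruence generated by the axioms of a g-module and the given
   action of H + E on Lam. The universal property of induction is [ind_univ]. *)
Section Induced.
Variables (k : fieldType) (Lam : hmod k).

Inductive vterm : int -> Type :=
| vin i (v : Lam i) : vterm i
| vact (x : sl2) i j (t : vterm i) : vterm j
| vadd i (t s : vterm i) : vterm i
| vscale i (a : k) (t : vterm i) : vterm i.

Inductive veq : forall i, vterm i -> vterm i -> Prop :=
| veq_refl i (t : vterm i) : veq t t
| veq_sym i (t s : vterm i) : veq t s -> veq s t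
| veq_trans i (t s r : vterm i) : veq t s -> veq s r -> veq t r
| veq_act x i j (t s : vterm i) : veq t s -> veq (vact x j t) (vact x j s)
| veq_add i (t t' s s' : vterm i) :
    veq t t' -> veq s s' -> veq (vadd t s) (vadd t' s')
| veq_scale i a (t s : vterm i) : veq t s -> veq (vscale a t) (vscale a s)
| veq_addA i (t s r : vterm i) : veq (vadd t (vadd s r)) (vadd (vadd t s) r)
| veq_addC i (t s : vterm i) : veq (vadd t s) (vadd s t)
| veq_add0 i (t : vterm i) : veq (vadd (vin 0) t) t
| veq_addN i (t : vterm i) : veq (vadd (vscale (-1) t) t) (vin 0)
| veq_scaleA i a b (t : vterm i) :
    veq (vscale a (vscale b t)) (vscale (a * b) t)
| veq_scale1 i (t : vterm i) : veq (vscale 1 t) t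
| veq_scaleDr i a (t s : vterm i) :
    veq (vscale a (vadd t s)) (vadd (vscale a t) (vscale a s))
| veq_scaleDl i a b (t : vterm i) :
    veq (vscale (a + b) t) (vadd (vscale a t) (vscale b t))
| veq_act_lin x i j a (t s : vterm i) :
    veq (vact x j (vadd (vscale a t) s))
        (vadd (vscale a (vact x j t)) (vact x j s))
| veq_br x y i j l (t : vterm i) :
    veq (vadd (vact x l (vact y j t))
              (vscale (-1) (vact y l (vact x (i + (l - j)) t))))
        (vscale (br x y).1%:~R (vact (br x y).2 l t))
| veq_in_lin i a (u v : Lam i) :
    veq (vin (a *: u + v)) (vadd (vscale a (vin u)) (vin v))
| veq_in_H i j (v : Lam i) : veq (vact H j (vin v)) (vin (hact j v))
| veq_in_E i j (v : Lam i) : veq (vact E j (vin v)) (vin 0).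

Definition ind_pre (i : int) : preVect k :=
  @PreVect k (vterm i) (@veq i) (vin 0) (@vadd i) (@vscale i)
    (@veq_refl i) (@veq_sym i) (@veq_trans i)
    (fun _ _ _ _ => @veq_add i _ _ _ _) (@veq_scale i)
    (@veq_addA i) (@veq_addC i) (@veq_add0 i) (@veq_addN i)
    (@veq_scaleA i) (@veq_scale1 i) (@veq_scaleDr i) (@veq_scaleDl i).

Definition ind_car (i : int) : lmodType k := pquot (ind_pre i).
Definition ind_pi i (t : vterm i) : ind_car i := ppi (t : ind_pre i).
Definition ind_act (x : sl2) i j (q : ind_car i) : ind_car j :=
  ind_pi (vact x j (prepr q)).

Lemma ind_actE x i j (t : vterm i) :
  ind_act x j (ind_pi t) = ind_pi (vact x j t).
Proof. apply/ppi_eq; apply: veq_act; exact: (prepr_pi (t : ind_pre i)). Qed.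

Lemma ind_piP i (q : ind_car i) : exists t : vterm i, q = ind_pi t.
Proof. by exists (prepr q); rewrite /ind_pi preprK. Qed.

Lemma ind_pi_add i (t s : vterm i) : ind_pi (vadd t s) = ind_pi t + ind_pi s.
Proof. exact: (@ppiD _ (ind_pre i)). Qed.
Lemma ind_pi_scale i a (t : vterm i) : ind_pi (vscale a t) = a *: ind_pi t.
Proof. exact: (@ppiZ _ (ind_pre i)). Qed.

Fact ind_act_lin x i j : linear (@ind_act x i j).
Proof.
move=> a p q; have [t ->] := ind_piP p; have [s ->] := ind_piP q.
rewrite -ind_pi_scale -ind_pi_add !ind_actE -ind_pi_scale -ind_pi_add.
exact/ppi_eq/veq_act_lin.
Qed.

Fact ind_act_br x y i j l (q : ind_car i) :
  ind_act x l (ind_act y j q) - ind_act y l (ind_act x (i + (l - j)) q)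
  = (br x y).1%:~R *: ind_act (br x y).2 l q.
Proof.
have [t ->] := ind_piP q.
rewrite !ind_actE -scaleN1r -!ind_pi_scale -!ind_pi_add.
exact/ppi_eq/veq_br.
Qed.

Definition Ind : gmod k := @GMod k ind_car ind_act ind_act_lin ind_act_br.

Definition ind_in i (v : Lam i) : Ind i := ind_pi (vin v).

Lemma ind_in_lin i : linear (@ind_in i).
Proof.
move=> a u v; rewrite /ind_in -ind_pi_scale -ind_pi_add.
exact/ppi_eq/veq_in_lin.
Qed.
Lemma ind_in0 i : ind_in (0 : Lam i) = 0. Proof. by []. Qed.
Lemma ind_in_H i j (v : Lam i) : act H j (ind_in v) = ind_in (hact j v).
Proof. rewrite /= ind_actE; exact/ppi_eq/veq_in_H. Qed.
Lemma ind_in_E i j (v : Lam i) : act E j (ind_in v) = 0.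
Proof. rewrite /= ind_actE -ind_in0; exact/ppi_eq/veq_in_E. Qed.

Lemma ind_ind (Q : forall i, Ind i -> Prop) :
  (forall i (v : Lam i), Q i (ind_in v)) ->
  (forall x i j (v : Ind i), Q i v -> Q j (act x j v)) ->
  (forall i (u v : Ind i), Q i u -> Q i v -> Q i (u + v)) ->
  (forall i a (v : Ind i), Q i v -> Q i (a *: v)) ->
  forall i (v : Ind i), Q i v.
Proof.
move=> Qin Qact Qadd Qsc i v; have [t ->] := ind_piP v; elim: t => {i v}.
- exact: Qin.
- by move=> x i j t IH; rewrite -ind_actE; apply: Qact.
- by move=> i t IHt s IHs; rewrite ind_pi_add; apply: Qadd.
- by move=> i a t IH; rewrite ind_pi_scale; apply: Qsc.
Qed.

Section Universal.
Variables (M : gmod k) (f : forall i, Lam i -> M i).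
Hypothesis f_lin : forall i, linear (f (i := i)).
Hypothesis f_H : forall i j (v : Lam i), act H j (f v) = f (hact j v).
Hypothesis f_E : forall i j (v : Lam i), act E j (f v) = 0.

Fixpoint vev i (t : vterm i) : M i :=
  match t in vterm i return M i with
  | vin i v => f v
  | vact x i j t => act x j (vev t)
  | vadd i t s => vev t + vev s
  | vscale i a t => a *: vev t
  end.

Lemma f0 i : f (0 : Lam i) = 0.
Proof.
have := f_lin (-1) (0 : Lam i) 0.
by rewrite scaler0 addr0 scaleN1r addNr.
Qed.

Lemma vev_eq i (t s : vterm i) : veq t s -> vev t = vev s.
Proof.
elim=> {i t s} //=.
- by move=> i t s r _ -> _ ->.
- by move=> x i j t s _ ->.
- by move=> i t t' s s' _ -> _ ->.
- by move=> i a t s _ ->.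
- by move=> i t s r; rewrite addrA.
- by move=> i t s; rewrite addrC.
- by move=> i t; rewrite f0 add0r.
- by move=> i t; rewrite f0 scaleN1r addNr.
- by move=> i a b t; rewrite scalerA.
- by move=> i t; rewrite scale1r.
- by move=> i a t s; rewrite scalerDr.
- by move=> i a b t; rewrite scalerDl.
- by move=> x i j a t s; rewrite act_lin.
- by move=> x y i j l t; rewrite scaleN1r act_br.
- by move=> i j v; rewrite f_E f0.
Qed.

Lemma ind_univ : exists! g : forall i, Ind i -> M i,
  [/\ forall i, linear (g i),
      forall x i j (v : Ind i), g j (act x j v) = act x j (g i v) &
      forall i (v : Lam i), g i (ind_in v) = f v].
Proof.
pose g i (q : Ind i) : M i := vev (prepr (q : ind_car i)).
have gE i (t : vterm i) : g i (ind_pi t) = vev t.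
  by apply: vev_eq; exact: (prepr_pi (t : ind_pre i)).
exists g; split.
  split.
  - move=> i a p q; have [t ->] := ind_piP p; have [s ->] := ind_piP q.
    by rewrite -ind_pi_scale -ind_pi_add !gE.
  - by move=> x i j q; have [t ->] := ind_piP q; rewrite /= ind_actE !gE.
  - by move=> i v; rewrite gE.
move=> g' [g'lin g'act g'in].
apply: functional_extensionality_dep => i; apply: functional_extensionality_dep => q.
have g'0 j : g' j 0 = 0.
  by have := g'lin j (-1) 0 0; rewrite scaler0 addr0 scaleN1r addNr.
have [t ->] := ind_piP q; rewrite gE; elim: t => {i q} /=.
- by move=> i v; rewrite -g'in.
- by move=> x i j t ->; rewrite -g'act /= ind_actE.
- by move=> i t -> s ->; rewrite ind_pi_add -[ind_pi t]scale1r g'lin !scale1r.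
- by move=> i a t ->; rewrite ind_pi_scale -[_ *: ind_pi t]addr0 g'lin g'0 addr0.
Qed.

End Universal.

(* Lam is identified with its image in Ind. *)
Definition meets_trivially (N : submod Ind) : Prop :=
  forall i (v : Lam i), N i (ind_in v) -> ind_in v = 0.

(* The sum of all submodules having trivial intersection with Lam. If h(0) acts on
   Lam by a scalar, this is itself such a submodule ([rad_meets_trivially]), hence
   the unique maximal one ([rad_max]). *)
Inductive rad_mem : forall i, Ind i -> Prop :=
| rad_sub (N : submod Ind) i (v : Ind i) :
    meets_trivially N -> N i v -> rad_mem v
| rad_0 i : rad_mem (0 : Ind i)
| rad_D i (u v : Ind i) : rad_mem u -> rad_mem v -> rad_mem (u + v).

Definition rad : submod Ind.
Proof.
exists rad_mem.
- exact: rad_0.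
- exact: rad_D.
- move=> i a v; elim=> {i v}.
  + by move=> N i v tN Nv; apply: (rad_sub tN); apply: smemZ.
  + by move=> i; rewrite scaler0; apply: rad_0.
  + by move=> i u v _ IHu _ IHv; rewrite scalerDr; apply: rad_D.
- move=> x i j v h; elim: h j => {i v}.
  + by move=> N i v tN Nv j; apply: (rad_sub tN); apply: smem_act.
  + move=> i j; have := @act_lin _ Ind x i j (-1) 0 0.
    by rewrite scaler0 addr0 scaleN1r addNr => ->; apply: rad_0.
  + move=> i u v _ IHu _ IHv j.
    by have := @act_lin _ Ind x i j 1 u v; rewrite !scale1r => ->; apply: rad_D.
Defined.

Lemma rad_max (N : submod Ind) : meets_trivially N -> sub_le N rad.
Proof. by move=> tN i v Nv; apply: (rad_sub tN). Qed.

(* L(Lam) *)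
Definition irrquo : gmod k := subquot (fullsub Ind) rad.

Section RadTrivial.
Local Arguments gcar : simpl never.
Local Arguments act : simpl never.
Hypothesis char0 : [pchar k] =i pred0.
Variable c : k.
Hypothesis h0_scal : forall i (v : Lam i), hact i v = c *: v.

Lemma act0 x i j : act x j (0 : Ind i) = 0.
Proof.
have := @act_lin _ Ind x i j (-1) 0 0.
by rewrite scaler0 addr0 scaleN1r addNr.
Qed.
Lemma actD x i j (u v : Ind i) : act x j (u + v) = act x j u + act x j v.
Proof. by have := @act_lin _ Ind x i j 1 u v; rewrite !scale1r. Qed.
Lemma actZ x i j a (u : Ind i) : act x j (a *: u) = a *: act x j u.
Proof. by have := @act_lin _ Ind x i j a u 0; rewrite act0 !addr0. Qed.
Lemma act_sum x i j m (u : nat -> Ind i) :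
  act x j (\sum_(n < m) u n) = \sum_(n < m) act x j (u n).
Proof.
elim: m => [|m IH]; first by rewrite !big_ord0 act0.
by rewrite !big_ord_recr /= actD IH.
Qed.

(* level n: the span of f(k_1) ... f(k_n) Lam *)
Inductive lev : nat -> forall i, Ind i -> Prop :=
| lev_in i (v : Lam i) : lev 0 (ind_in v)
| lev_F n i j (v : Ind i) : lev n v -> lev n.+1 (act F j v)
| lev_0 n i : lev n (0 : Ind i)
| lev_lin n i a (u v : Ind i) : lev n u -> lev n v -> lev n (a *: u + v).

Lemma lev_D n i (u v : Ind i) : lev n u -> lev n v -> lev n (u + v).
Proof. by move=> hu hv; rewrite -[u]scale1r; apply: lev_lin. Qed.
Lemma lev_Z n i a (u : Ind i) : lev n u -> lev n (a *: u).
Proof. by move=> hu; rewrite -[_ *: _]addr0; apply: lev_lin => //; apply: lev_0. Qed.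

Lemma act_brE x y i j l (v : Ind i) :
  act x l (act y j v) = (br x y).1%:~R *: act (br x y).2 l v
    + act y l (act x (i + (l - j)) v).
Proof. by rewrite -(@act_br _ Ind x y i j l v) subrK. Qed.

Lemma lev_H n i j (v : Ind i) : lev n v -> lev n (act H j v).
Proof.
move=> h; elim: h j => {n i v}.
- by move=> i v j; rewrite ind_in_H; apply: lev_in.
- move=> n i j v hv IH l; rewrite act_brE; apply: lev_lin; first exact: lev_F.
  exact: lev_F.
- by move=> n i j; rewrite act0; apply: lev_0.
- by move=> n i a u v _ IHu _ IHv j; rewrite act_lin; apply: lev_lin.
Qed.

Lemma lev_E n i j (v : Ind i) :
  lev n v -> if n is n'.+1 then lev n' (act E j v) else act E j v = 0.
Proof.
move=> h; elim: h j => {n i v}.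
- by move=> i v j; rewrite ind_in_E.
- move=> n i j v hv IH l; rewrite act_brE; apply: lev_lin; first exact: lev_H.
  case: n hv IH => [|n] hv IH; last exact/lev_F/IH.
  by rewrite IH act0; apply: lev_0.
- by move=> [|n] i j; rewrite act0 //; apply: lev_0.
- move=> [|n] i a u v _ IHu _ IHv j; rewrite act_lin; last exact: lev_lin.
  by rewrite IHu IHv scaler0 addr0.
Qed.

Lemma lev_h0 n i (v : Ind i) : lev n v -> act H i v = (c - n.*2%:R) *: v.
Proof.
elim=> {n i v}.
- move=> i v; rewrite ind_in_H h0_scal subr0.
  by have := ind_in_lin c v 0; rewrite ind_in0 !addr0.
- move=> n i j v _ IH; rewrite act_brE /=.
  have -> : i + (j - j) = i by rewrite subrr addr0.
  rewrite IH actZ -scalerDl doubleS; congr (_ *: _).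
  by rewrite -[n.*2.+2]addn2 natrD opprD addrC -addrA.
- by move=> n i; rewrite act0 scaler0.
- move=> n i a u v _ IHu _ IHv; rewrite act_lin IHu IHv scalerDr.
  by rewrite !scalerA mulrC.
Qed.

Lemma lev0 i (v : Ind i) : lev 0 v -> exists v0, v = ind_in v0.
Proof.
move eqn: 0%N => n h; elim: h eqn => {n i v} //.
- by move=> i v _; exists v.
- by move=> n i _; exists 0; rewrite ind_in0.
- move=> n i a u v _ IHu _ IHv /[dup] /IHu[u0 ->] /IHv[v0 ->].
  by exists (a *: u0 + v0); rewrite ind_in_lin.
Qed.

Definition decomposes i (v : Ind i) (u : nat -> Ind i) : Prop :=
  (forall n, lev n (u n)) /\
  exists m0, forall m, (m0 <= m)%N -> v = \sum_(n < m) u n.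

Lemma ind_decomposes i (v : Ind i) : exists u, decomposes v u.
Proof.
move: i v; apply: ind_ind.
- move=> i v; exists (fun n => if n is 0 then ind_in v else 0); split.
    by case=> [|n]; [apply: lev_in | apply: lev_0].
  exists 1%N => -[//|m] _; rewrite big_ord_recl /= big1 ?addr0 //.
- move=> x i j v [u [hu [m0 hm0]]]; case: x.
  + exists (fun n => act E j (u n.+1)); split.
      by move=> n; apply: (lev_E _ (hu n.+1)).
    exists m0 => m lm; rewrite (hm0 m.+1 (leqW lm)) act_sum big_ord_recl.
    by rewrite (lev_E _ (hu 0%N)) add0r.
  + exists (fun n => act H j (u n)); split; first by move=> n; apply: lev_H.
    by exists m0 => m lm; rewrite (hm0 m lm) act_sum.
  + exists (fun n => if n is n'.+1 then act F j (u n') else 0); split.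
      by case=> [|n]; [apply: lev_0 | apply: lev_F].
    exists m0.+1 => -[//|m] lm; rewrite (hm0 m lm) act_sum big_ord_recl.
    by rewrite add0r.
- move=> i v w [u [hu [m0 hm0]]] [u' [hu' [m0' hm0']]].
  exists (fun n => u n + u' n); split; first by move=> n; apply: lev_D.
  exists (maxn m0 m0') => m; rewrite geq_max => /andP[l1 l2].
  by rewrite (hm0 m l1) (hm0' m l2) big_split.
- move=> i a v [u [hu [m0 hm0]]]; exists (fun n => a *: u n); split.
    by move=> n; apply: lev_Z.
  by exists m0 => m lm; rewrite (hm0 m lm) scaler_sumr.
Qed.

Lemma lev_sep (N : submod Ind) i m (u : nat -> Ind i) :
  (forall n, lev n (u n)) -> N i (\sum_(n < m) u n) ->
  forall n, (n < m)%N -> N i (u n).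
Proof.
elim: m u => // m IH u hu hN.
have hlt n : (n < m)%N -> N i (u n).
  move=> lnm; pose u' n := (m.*2%:R - n.*2%:R : k) *: u n.
  have : N i (u' n).
    apply: IH lnm; first by move=> r; apply: lev_Z.
    have -> : \sum_(n < m) u' n = act H i (\sum_(n < m.+1) u n)
        + (m.*2%:R - c) *: \sum_(n < m.+1) u n.
      rewrite act_sum scaler_sumr -big_split big_ord_recr /=.
      rewrite (lev_h0 (hu m)) -scalerDl addrC addrA subrK subrr scale0r add0r.
      apply: eq_bigr => r _; rewrite (lev_h0 (hu r)) -scalerDl; congr (_ *: _).
      by rewrite [RHS]addrC addrA subrK.
    apply: smemD; last exact: smemZ.
    exact: smem_act.
  move=> /(smemZ (m.*2%:R - n.*2%:R)^-1); rewrite /u' scalerA mulVf ?scale1r //.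
  rewrite -natrB ?leq_double; last exact: ltnW.
  move/pcharf0P: char0 => ->; rewrite -doubleB double_eq0.
  by rewrite subn_eq0 -ltnNge.
move=> n; rewrite ltnS leq_eqVlt => /orP[/eqP ->|]; last exact: hlt.
have -> : u m = \sum_(n < m.+1) u n + (-1) *: \sum_(n < m) u n.
  by rewrite big_ord_recr /= scaleN1r addrAC subrr add0r.
apply: smemD => //; apply: smemZ.
elim/big_rec: _ => [|r x _ hx]; first exact: smem0.
by apply: smemD => //; apply: hlt.
Qed.

Lemma rad_decomposes i (v : Ind i) :
  rad i v -> exists u, decomposes v u /\ u 0 = 0.
Proof.
elim=> {i v}.
- move=> N i v tN Nv; have [u [hu [m0 hm0]]] := ind_decomposes v.
  exists u; split; first by split=> //; exists m0.
  have [v0 e] := lev0 (hu 0%N); rewrite e; apply: tN; rewrite -e.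
  apply: (lev_sep (m := m0.+1) hu) => //.
  by rewrite -(hm0 m0.+1).
- move=> i; exists (fun _ => 0); split=> //; split; first by move=> n; apply: lev_0.
  by exists 0%N => m _; rewrite big1.
- move=> i v w _ [u [[hu [m0 hm0]] e]] _ [u' [[hu' [m0' hm0']] e']].
  exists (fun n => u n + u' n); split; last by rewrite e e' addr0.
  split; first by move=> n; apply: lev_D.
  exists (maxn m0 m0') => m; rewrite geq_max => /andP[l1 l2].
  by rewrite (hm0 m l1) (hm0' m l2) big_split.
Qed.

Definition zerosub : submod Ind.
Proof.
exists (fun i (v : Ind i) => v = 0) => //.
- by move=> i u v -> ->; rewrite addr0.
- by move=> i a v ->; rewrite scaler0.
- by move=> x i j v ->; rewrite act0.
Defined.

Lemma rad_meets_trivially : meets_trivially rad.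
Proof.
move=> i v /rad_decomposes[u [[hu [m0 hm0]] u0]].
pose u' n := if n is 0 then (-1) *: ind_in v else u n.
have hu' n : lev n (u' n) by case: n => [|n] //; apply/lev_Z/lev_in.
have : zerosub i (u' 0).
  apply: (lev_sep (m := m0.+1) hu') => //=.
  rewrite big_ord_recl /= {1}(hm0 m0.+1) // big_ord_recl u0 add0r.
  by rewrite scaleN1r addNr.
by move=> /= /eqP; rewrite scaleN1r oppr_eq0 => /eqP.
Qed.

End RadTrivial.
End Induced.

Section Modules.
Variable k : fieldType.

(* k u_0: the dimension (i == 0) in degree i is the boolean coerced to nat. *)
Definition triv_act (i j : int) (v : 'rV[k]_(i == 0)) : 'rV[k]_(j == 0) := 0.

Definition triv : hmod k.
Proof.
refine (@HMod k (fun i => 'rV[k]_(i == 0)) triv_act _ _).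
- by move=> i j a u v; rewrite /triv_act scaler0 addr0.
- by [].
Defined.

Definition M0 : gmod k := Ind triv.

(* W(phi)_i is the set of the c such that c t^i lies in the image of
   U(H) -> k[t, t^-1], h(n) |-> phi(n) t^n. An element of U(H) of degree i is
   given as the list u of its terms a h(s_1) ... h(s_r), with
   s_1 + ... + s_r = i. *)
Definition W_mem (phi : int -> k) (i : int) (c : k) : Prop :=
  exists u : seq (k * seq int),
    (forall m, m \in u -> \sum_(n <- m.2) n = i) /\
    c = \sum_(m <- u) m.1 * \prod_(n <- m.2) phi n.

Definition W_pred (phi : int -> k) (i : int) : {pred k^o} :=
  fun c => `[< W_mem phi i c >].

Lemma W_closed phi i : submod_closed (W_pred phi i).
Proof.
split; first by apply/asboolP; exists [::]; rewrite big_nil; split.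
move=> a x y /asboolP[u [hu ->]] /asboolP[u' [hu' ->]]; apply/asboolP.
exists ([seq (a * m.1, m.2) | m <- u] ++ u'); split.
  move=> m; rewrite mem_cat => /orP[/mapP[m' /hu h ->]|/hu'] //.
rewrite big_cat big_map /=; congr (_ + _).
by rewrite [LHS]mulr_sumr; apply: eq_bigr => m _; rewrite mulrA.
Qed.

HB.instance Definition _ phi i :=
  GRing.isSubmodClosed.Build k k^o (W_pred phi i) (W_closed phi i).

Record W_car (phi : int -> k) (i : int) := WCar {
  W_val :> k^o;
  W_valP : W_val \in W_pred phi i }.
HB.instance Definition _ phi i := [isSub for @W_val phi i].
HB.instance Definition _ phi i := [Choice of W_car phi i by <:].
HB.instance Definition _ phi i := [SubChoice_isSubLmodule of W_car phi i by <:].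

Lemma W_mem_act phi i j c : W_mem phi i c -> W_mem phi j (phi (j - i) * c).
Proof.
case=> u [hu ->]; exists [seq (m.1, (j - i) :: m.2) | m <- u]; split.
  by move=> _ /mapP[m mu ->] /=; rewrite big_cons (hu m mu) subrK.
rewrite big_map big_distrr /=; apply: eq_bigr => m _.
by rewrite big_cons mulrCA.
Qed.

(* h(n) acts as multiplication by phi(n) t^n *)
Definition W_act (phi : int -> k) (i j : int) (v : W_car phi i) : W_car phi j :=
  WCar (asboolT (W_mem_act j (asboolW (W_valP v)))).

Definition W (phi : int -> k) : hmod k.
Proof.
refine (@HMod k (W_car phi) (@W_act phi) _ _).
- move=> i j a u v; apply: val_inj => /=.
  by rewrite mulrDr /GRing.scale /= mulrCA.
- move=> i j l v; apply: val_inj => /=.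
  have -> : l - (i + (l - j)) = j - i.
    by rewrite opprD opprB addrCA [l + _]addrC subrK addrC.
  by rewrite [i + _]addrC addrK mulrCA.
Defined.

Lemma W_h0 phi i (v : W phi i) : hact i v = phi 0 *: v.
Proof. by apply: val_inj; rewrite /= subrr. Qed.

Definition Lphi (phi : int -> k) : gmod k := irrquo (W phi).

Definition Exp_n (n : nat) (phi : int -> k) : Prop :=
  exists alpha : 'I_n -> k,
    (forall i, alpha i != 0) /\
    forall j : int, phi j = - 2%:R * \sum_(i < n) alpha i ^ j.

Definition Exp (phi : int -> k) : Prop := exists n, Exp_n n phi.

End Modules.

Arguments M0 k : clear implicits.

(* Main.v *)
Require Import Defs.
From mathcomp Require Import all_boot all_order all_algebra perm.
From mathcomp Require Import boolp classical_sets functions.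
From mathcomp Require Import mpoly ring.

(* In level n, i.e. in h(0)-weight -2n, M(0) is the space of symmetric Laurent
   polynomials in x_1, ..., x_n, on which h(l) acts as -2 (x_1^l + ... + x_n^l).

   Let phi be given by a_1, ..., a_n. The vector det[f(j - i)] u_0 is the symmetric
   polynomial prod_(i<>j) (x_i - x_j), up to a unit; it is annihilated by E modulo
   the kernel of the map to the tensor product of the evaluation modules k[z] at any
   points b_1, ..., b_n. Applying U(H) to it and dividing by the values of the
   product at points b tending to a, one gets a map onto W(phi). Goursat's lemma in
   M(0) + L(phi) then exhibits L(phi) as a subquotient. It is irreducible because
   every nonzero homogeneous element of W(phi) is invertible: if phi(l) <> 0, then
   phi(-jl) <> 0 for some j > 0, as not all power sums of nonzero numbers vanish.

   Conversely, let S = N/P be irreducible, and v in S the class of a vector m of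
   minimal level n in N, so that E v = 0. The Laurent polynomials p such that the
   symmetrizations of all the x^e p m are in P form a proper ideal, because
   symmetric functions are polynomials in the power sums. By the Nullstellensatz
   the ideal has a zero a with nonzero coordinates. The annihilator of v in U(H) is
   then in the kernel of the character phi given by a, and Goursat's lemma in
   S + L(phi) yields an isomorphism. *)

Set Implicit Arguments.
Unset Strict Implicit.
Unset Printing Implicit Defensive.
Import GRing.Theory Num.Theory.
Local Open Scope ring_scope.

(** * Zeros of ideals in the torus *)

Section Ideals.
Variable B : comNzRingType.

Record is_ideal (J : B -> Prop) : Prop := IsIdeal {
  ideal0 : J 0;
  idealD : forall x y, J x -> J y -> J (x + y);
  idealMl : forall a x, J x -> J (a * x) }.

Record is_prime (J : B -> Prop) : Prop := IsPrime {
  prime_ideal : is_ideal J;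
  prime1 : ~ J 1;
  primeM : forall x y, J (x * y) -> J x \/ J y }.

Variable J : B -> Prop.
Hypothesis idJ : is_ideal J.

Lemma idealMr a x : J x -> J (x * a).
Proof. by rewrite mulrC; apply: idealMl. Qed.

Lemma idealN x : J x -> J (- x).
Proof. by rewrite -mulN1r; apply: idealMl. Qed.

Lemma idealB x y : J x -> J y -> J (x - y).
Proof. by move=> hx hy; apply: idealD => //; apply: idealN. Qed.

Lemma ideal_sum I (r : seq I) (P : pred I) (u : I -> B) :
  (forall i, P i -> J (u i)) -> J (\sum_(i <- r | P i) u i).
Proof.
move=> hu; elim/big_rec: _ => [|i x Pi hx]; first exact: ideal0.
by apply: idealD => //; apply: hu.
Qed.

Definition adjoin (I : B -> Prop) (x : B) : B -> Prop :=
  fun z => exists a r, I a /\ z = a + r * x.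

Lemma adjoin_ideal I x : is_ideal I -> is_ideal (adjoin I x).
Proof.
move=> idI; split.
- by exists 0, 0; split; [apply: ideal0 | rewrite mul0r addr0].
- move=> _ _ [a [r [Ia ->]]] [b [s [Ib ->]]]; exists (a + b), (r + s).
  by split; [apply: idealD | rewrite mulrDl addrACA].
- move=> c _ [a [r [Ia ->]]]; exists (c * a), (c * r).
  by split; [apply: idealMl | rewrite mulrDr mulrA].
Qed.

(** An ideal maximal among those containing J and no power of v is prime. *)
Lemma exists_prime v : (forall n, ~ J (v ^+ n)) ->
  exists m, [/\ is_prime m, forall x, J x -> m x & ~ m v].
Proof.
move=> Jv.
pose good (I : B -> Prop) :=
  [/\ is_ideal I, forall x, J x -> I x & forall n, ~ I (v ^+ n)].
pose P (I : set B) := (forall x, ~ I x) \/ good I.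
have [|m [Pm maxm]] := @Zorn_bigcup _ P.
  move=> C CP Ctot.
  have goodC I x : C I -> I x -> good I.
    by move=> CI Ix; case: (CP _ CI) => // h; case: (h x).
  have [[x [I CI Ix]]|noC] := pselect (exists x, (\bigcup_(X in C) X)%classic x);
    last by left=> x hx; apply: noC; exists x.
  have [idI JI Iv] := goodC _ _ CI Ix.
  right; split.
  - split.
    + by exists I => //; apply: ideal0.
    + move=> y z [Y CY Yy] [Z CZ Zz].
      have [idY _ _] := goodC _ _ CY Yy; have [idZ _ _] := goodC _ _ CZ Zz.
      have [YZ|ZY] := Ctot _ _ CY CZ.
        by exists Z => //; apply: idealD => //; apply: YZ.
      by exists Y => //; apply: idealD => //; apply: ZY.
    + move=> a y [Y CY Yy]; have [idY _ _] := goodC _ _ CY Yy.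
      by exists Y => //; apply: idealMl.
  - by move=> y Jy; exists I => //; apply: JI.
  - by move=> n [Y CY Yy]; have [_ _ /(_ n)] := goodC _ _ CY Yy.
have [idm Jm mv] : good m.
  have [m0|//] := Pm; exfalso; apply: (maxm J); last by right; split.
  split; first by move=> x /m0.
  by move=> /(_ 0 (ideal0 idJ)) /m0.
exists m; split=> //; last by have := mv 1%N; rewrite expr1.
split=> //; first exact: (mv 0%N).
have grow x : ~ m x -> exists n, adjoin m x (v ^+ n).
  move=> mx; apply: contrapT => noN; apply: (maxm (adjoin m x)).
    split; first by move=> y my; exists y, 0; rewrite mul0r addr0.
    move=> sub; apply: mx; apply: sub; exists 0, 1.
    by rewrite mul1r add0r; split=> //; apply: ideal0.
  right; split; first exact: adjoin_ideal.
    by move=> y /Jm my; exists y, 0; rewrite mul0r addr0.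
  by move=> n hn; apply: noN; exists n.
(* If x and y were both outside m, then v^n = a + r x and v^p = b + s y with a, b in m, and the
   product v^(n + p) would lie in m. *)
move=> x y mxy; apply: contrapT => /not_orP[/grow[n [a [r [ma en]]]]].
move=> /grow[p [b [s [mb ep]]]]; apply: (mv (n + p)%N).
rewrite exprD en ep mulrDl; apply: idealD => //.
  by rewrite mulrC; apply: idealMl.
rewrite mulrDr; apply: idealD => //; first exact: idealMl.
by rewrite mulrACA; apply: idealMl.
Qed.

End Ideals.

Lemma prime_exp (B : comNzRingType) (m : B -> Prop) x n :
  is_prime m -> ~ m x -> ~ m (x ^+ n).
Proof.
move=> pm mx; elim: n => [|n IH]; first exact: prime1.
by rewrite exprS => /(primeM pm)[].
Qed.

(** * Extension of a homomorphism by one variable *)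

Section Extension.
Variables (k : fieldType) (D : comNzRingType) (M : {poly D} -> Prop).
Hypothesis char0 : [pchar k] =i pred0.
Hypothesis kclosed : GRing.closed_field_axiom k.
Hypothesis pM : is_prime M.
Let idM : is_ideal M := prime_ideal pM.

Lemma closed_root (p : {poly k}) : (1 < size p)%N -> exists x, root p x.
Proof.
move=> sp; have lp : lead_coef p != 0.
  by rewrite lead_coef_eq0 -size_poly_gt0 ltnW.
have [] := @kclosed (size p).-1 (fun i => - p`_i / lead_coef p).
  by case: (size p) sp => [|[]].
move=> x hx; exists x; rewrite /root horner_coef.
have -> : size p = (size p).-1.+1 by rewrite prednK // ltnW.
rewrite big_ord_recr /= -/(lead_coef p) hx mulr_sumr -big_split /=.
apply/eqP/big1 => i _.
by rewrite !mulNr mulrN mulrCA mulrA mulfVK // subrr.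
Qed.

(** The images of 0, ..., [size p - 1] are distinct in characteristic zero, and more numerous than
    the roots of p. *)
Lemma exists_nonroot (K : fieldType) (p : {poly K}) :
  [pchar K] =i pred0 -> p != 0 -> exists x, ~~ root p x.
Proof.
move=> cK p0; apply: contrapT => h.
pose s := [seq (i%:R : K) | i <- iota 0 (size p)].
have us : uniq s.
  rewrite map_inj_in_uniq ?iota_uniq // => i j _ _.
  wlog ij : i j / (i <= j)%N.
    by move=> hw e; have [/hw|/ltnW/hw ji] := leqP i j; [apply | apply/esym/ji].
  move/esym/eqP; rewrite -subr_eq0 -natrB // ((pcharf0P _).1 cK) subn_eq0 => ji.
  by apply/eqP; rewrite eqn_leq ij.
suff /(max_poly_roots p0)/(_ us) : all (root p) s.
  by rewrite size_map size_iota ltnn.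
by apply/allP => x _; apply: contrapT => hx; apply: h; exists x; apply/negP.
Qed.

Lemma M_C0 : M 0%:P.
Proof. by rewrite polyC0; apply: ideal0. Qed.

Lemma M_coefs (p : {poly D}) : (forall i, M (p`_i)%:P) -> M p.
Proof.
move=> h; rewrite -[p]coefK poly_def; apply: ideal_sum => // i _.
by rewrite -mul_polyC; apply: idealMr.
Qed.

Lemma M_trunc (p : {poly D}) n :
  (forall i, (n <= i)%N -> M (p`_i)%:P) ->
  forall i, M ((p - take_poly n p)`_i)%:P.
Proof.
move=> h i; rewrite coefB coef_take_poly.
by case: ltnP => hi; [rewrite subrr; apply: M_C0 | rewrite subr0; apply: h].
Qed.

Lemma M_sub p q : M (p - q) -> M p <-> M q.
Proof.
move=> h; split=> [hp|hq]; last by rewrite -[p](subrK q); apply: idealD.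
by rewrite -[q](subKr p); apply: idealB.
Qed.

Lemma min_size (Q : {poly D} -> Prop) p :
  Q p -> exists q, Q q /\ forall r, Q r -> (size q <= size r)%N.
Proof.
move=> Qp; have ex : exists n, `[< exists q, Q q /\ size q = n >].
  by exists (size p); apply/asboolP; exists p.
case: (ex_minnP ex) => n /asboolP[q [Qq <-]] h; exists q; split=> // r Qr.
by apply: h; apply/asboolP; exists r.
Qed.

(** As Q only depends on the coefficients modulo M, a leading coefficient in M could be cut off,
    against minimality. *)
Lemma min_lead (Q : {poly D} -> Prop) q :
  (forall p r : {poly D}, (forall i, M ((p - r)`_i)%:P) -> Q p -> Q r) ->
  Q q -> (forall r, Q r -> (size q <= size r)%N) -> q != 0 ->
  ~ M (lead_coef q)%:P.
Proof.
move=> QM Qq minq q0 Ml.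
have Qt : Q (take_poly (size q).-1 q).
  apply: QM Qq; apply: M_trunc => i; rewrite leq_eqVlt => /orP[/eqP <- //|].
  rewrite prednK ?size_poly_gt0 // => hi.
  by rewrite nth_default //; apply: M_C0.
have := leq_trans (minq _ Qt) (size_take_poly _ _).
by rewrite -ltnS prednK ?size_poly_gt0 // ltnn.
Qed.

(* If M contains a polynomial p with a coefficient outside M, z is a root of the
   image of such a p of minimal size; otherwise any z outside a finite set will
   do. In the first case the ideal (M, v) contains a constant c outside M, and u
   is c times the leading coefficient of p. *)
Lemma extend_hom (v : {poly D}) : ~ M v ->
  exists u : D, ~ M u%:P /\
  forall f : {rmorphism D -> k}, (forall x, M x%:P -> f x = 0) -> f u != 0 ->
  exists z : k, (forall p, M p -> (map_poly f p).[z] = 0) /\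
    (map_poly f v).[z] != 0.
Proof.
move=> Mv.
pose good p := M p /\ exists i, ~ M (p`_i)%:P.
have [[p1 gp1]|nog] := pselect (exists p, good p); last first.
  have [i Mi] : exists i, ~ M (v`_i)%:P.
    by apply: contrapT => h; apply/Mv/M_coefs => i; apply: contrapT => hi; apply: h; exists i.
  exists v`_i; split=> // f fM fu.
  have [|z hz] := @exists_nonroot _ (map_poly f v) char0.
    by apply: contra fu => /eqP e; rewrite -coef_map e coef0.
  exists z; split=> // p Mp; rewrite (_ : map_poly f p = 0) ?horner0 //.
  apply/polyP => j; rewrite coef_map coef0; apply: fM; apply: contrapT => hj.
  by apply: nog; exists p; split=> //; exists j.
have {p1 gp1} [p0 [[Mp0 [i0 hi0]] minp0]] := min_size gp1.
have smallM r : M r -> (size r < size p0)%N -> forall i, M (r`_i)%:P.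
  move=> Mr sr i; apply: contrapT => hi.
  by have := minp0 r; rewrite leqNgt sr; move=> /(_ (conj Mr (ex_intro _ i hi))).
have p00 : p0 != 0 by apply: contra_notN hi0 => /eqP ->; rewrite coef0; apply: M_C0.
have goodM (p r : {poly D}) : (forall i, M ((p - r)`_i)%:P) -> good p -> good r.
  move=> h [Mp [i hi]]; split; first by rewrite -(M_sub (M_coefs h)).
  exists i => ri; apply: hi; rewrite -[p](subrK r) coefD rmorphD.
  exact: (idealD idM (h i) ri).
have lp0 : ~ M (lead_coef p0)%:P.
  exact: (min_lead goodM (conj Mp0 (ex_intro _ i0 hi0)) minp0 p00).
(* The nonzero multiples of v modulo M. The aim is to show that one of minimal size is a
   constant. *)
pose V q := ~ M q /\ exists w, M (q - v * w).
have Vv : V v by split=> //; exists 1; rewrite mulr1 subrr; apply: ideal0.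
have VM p r : M (p - r) -> V p -> V r.
  move=> h [Mp [w hw]]; split; first by rewrite -(M_sub h).
  by exists w; rewrite -[r](subKr p) addrAC; apply: idealB.
have [q0 [Vq0 minq0]] := min_size Vv.
have q00 : q0 != 0 by apply: contra_notN Vq0.1 => /eqP ->; apply: ideal0.
have lq0 := min_lead (fun p r h => VM p r (M_coefs h)) Vq0 minq0 q00.
have Mlead p c N : ~ M p -> ~ M c%:P -> ~ M (c ^+ N *: p).
  rewrite -mul_polyC polyC_exp => Mp Mc /(primeM pM)[] //.
  exact: prime_exp.
(* Otherwise the pseudo-remainder of q0 by p0 would be a smaller element of V. *)
have sq0 : (size q0 < size p0)%N.
  rewrite ltnNge; apply/negP => le.
  have e := Pdiv.ComRing.rdivp_eq p0 q0.
  set h := Pdiv.Ring.rdivp _ _ in e; set r := Pdiv.Ring.rmodp _ _ in e.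
  have sr : (size r < size q0)%N.
    by apply: leq_trans le; rewrite Pdiv.Ring.ltn_rmodp.
  have Mr : M (lead_coef p0 ^+ Pdiv.Ring.rscalp q0 p0 *: q0 - r).
    by rewrite e addrK; apply: idealMl.
  have : V r; last by move/minq0; rewrite leqNgt sr.
  apply: (VM _ _ Mr); split; first exact: Mlead Vq0.1 lp0.
  have [_ [w hw]] := Vq0; exists (lead_coef p0 ^+ Pdiv.Ring.rscalp q0 p0 *: w).
  by rewrite -scalerAr -scalerBr -mul_polyC; apply: idealMl.
have e := Pdiv.ComRing.rdivp_eq q0 p0.
set h := Pdiv.Ring.rdivp _ _ in e; set r := Pdiv.Ring.rmodp _ _ in e.
have sr : (size r < size q0)%N by rewrite Pdiv.Ring.ltn_rmodp.
(* Modulo M, r is a multiple of v because q0 is one and p0 is in M; it is smaller than q0, so it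
   lies in M. Then h * q0 lies in M, and hence h does. *)
have Mr : M r.
  apply: contrapT => nr; have : V r; last by move/minq0; rewrite leqNgt sr.
  split=> //; have [_ [w hw]] := Vq0; exists (- (w * h)).
  have -> : r - v * - (w * h) = (r + h * q0) - h * (q0 - v * w).
    by ring.
  rewrite [r + _]addrC -e; apply: idealB => //; last exact: idealMl.
  by rewrite -mul_polyC; apply: idealMl.
have rM := smallM r Mr (ltn_trans sr sq0).
have Mh : M h.
  have : M (h * q0).
    rewrite -[h * q0](addrK r) -e; apply: idealB => //.
    by rewrite -mul_polyC; apply: idealMl.
  by case/(primeM pM) => // /Vq0.1.
(* If all coefficients of h were in M, so would be a power of [lead_coef q0] times
   [lead_coef p0]. *)
have [i [hi himax]] : exists i, ~ M (h`_i)%:P /\ forall j, (i < j)%N -> M (h`_j)%:P.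
  have [i hi] : exists i, ~ M (h`_i)%:P.
    apply: contrapT => nh; have allh j : M (h`_j)%:P.
      by apply: contrapT => hj; apply: nh; exists j.
    have := congr1 (fun p : {poly D} => p`_(size p0).-1) e; rewrite /= coefZ.
    rewrite -/(lead_coef p0) coefD coefM => e'.
    have : M (lead_coef q0 ^+ Pdiv.Ring.rscalp p0 q0 * lead_coef p0)%:P.
      rewrite e' rmorphD rmorph_sum; apply: idealD => //; last exact: rM.
      by apply: ideal_sum => // j _; rewrite /= rmorphM; apply: (idealMr idM _ (allh j)).
    rewrite rmorphM => /(primeM pM)[|//]; rewrite rmorphXn; exact: prime_exp.
  have ex : exists n, `[< ~ M (h`_n)%:P >] by exists i; apply/asboolP.
  have ub n : `[< ~ M (h`_n)%:P >] -> (n <= size h)%N.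
    move=> /asboolP hn; rewrite leqNgt; apply/negP => lt; apply: hn.
    by rewrite nth_default ?(ltnW lt) //; apply: M_C0.
  case: (ex_maxnP ex ub) => n /asboolP hn nmax; exists n; split=> // j nj.
  by apply: contrapT => hj; have := nmax j (introT (asboolP _) hj); rewrite leqNgt nj.
(* Cut off above degree i, h is still in M with a coefficient outside M, so p0 is not larger. *)
have si : (size p0 <= i.+1)%N.
  have Mt : M (h - take_poly i.+1 h).
    by apply/M_coefs/M_trunc => j; apply: himax.
  apply: leq_trans (size_take_poly i.+1 h); apply: minp0; split.
    by rewrite -(M_sub Mt).
  by exists i; rewrite coef_take_poly ltnSn.
(* If q0 had degree d > 0, the coefficient of degree i + d in h q0 + r would be [h_i * lead_coef q0]
   modulo M, but zero because p0 has no term of that degree. *)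
have sq1 : (size q0 <= 1)%N.
  rewrite leqNgt; apply/negP => gt1.
  pose d := (size q0).-1; pose N := (i + d)%N.
  have eq0 : size q0 = d.+1 by rewrite prednK ?size_poly_gt0.
  have d1 : (0 < d)%N by rewrite /d; case: (size q0) gt1 => [|[]].
  have iN : (i < N.+1)%N by rewrite ltnS leq_addr.
  have lt_N : (size p0 <= N)%N by rewrite (leq_trans si) // -addn1 leq_add2l.
  have := congr1 (fun p : {poly D} => p`_N) e; rewrite /= coefZ.
  rewrite [p0`_N]nth_default // mulr0 coefD coefM (bigD1 (Ordinal iN)) //=.
  rewrite addKn -/(lead_coef q0) => e0.
  have : M (h`_i * lead_coef q0)%:P; last first.
    by rewrite rmorphM => /(primeM pM)[].
  set T := (\sum_(_ < _ | _) _) in e0.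
  have -> : h`_i * lead_coef q0 = - (T + r`_N).
    by apply/eqP; rewrite -addr_eq0 addrA -e0.
  rewrite rmorphN; apply: idealN => //; rewrite rmorphD; apply: idealD => //; last exact: rM.
  rewrite rmorph_sum; apply: ideal_sum => // j /negP ji; rewrite rmorphM.
  have [ij|ij|ij] := ltngtP i j; first by apply: idealMr => //; apply: himax.
    rewrite [q0`_(N - j)]nth_default; last first.
      by rewrite eq0 /N -addnBAC ?(ltnW ij) // -add1n leq_add2r subn_gt0.
    by rewrite mulr0; apply: M_C0.
  by case: ji; apply/eqP/val_inj; rewrite /= ij.
have [c ec] : exists c, q0 = c%:P by exists q0`_0; exact: (size1_polyC sq1).
have Mc : ~ M c%:P by rewrite -ec; exact: Vq0.1.
exists (lead_coef p0 * c); split; first by rewrite rmorphM => /(primeM pM)[].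
move=> f fM; rewrite rmorphM mulf_eq0 => /norP[fl fc].
have [|z /rootP hz] := @closed_root (map_poly f p0).
  rewrite size_poly_eq // (leq_ltn_trans _ sq0) // size_poly_gt0 //.
(* The pseudo-remainder of p by p0 is in M and smaller than p0, so f kills its coefficients; now
   evaluate at the root z of p0. *)
have zM p : M p -> (map_poly f p).[z] = 0.
  move=> Mp; have e' := Pdiv.ComRing.rdivp_eq p0 p.
  set h' := Pdiv.Ring.rdivp _ _ in e'; set r' := Pdiv.Ring.rmodp _ _ in e'.
  have sr' : (size r' < size p0)%N by rewrite Pdiv.Ring.ltn_rmodp.
  have Mr' : M r'.
    rewrite -[r'](addKr (h' * p0)) -e' addrC; apply: idealB => //.
      by rewrite -mul_polyC; apply: idealMl.
    exact: idealMl.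
  have fr' : map_poly f r' = 0.
    by apply/polyP => j; rewrite coef_map coef0; apply: fM; apply: smallM.
  have := congr1 (fun q => (map_poly f q).[z]) e'; rewrite /=.
  rewrite map_polyZ rmorphD rmorphM /= fr' addr0 hornerM hz mulr0 hornerZ rmorphXn.
  by move/eqP; rewrite mulf_eq0 expf_eq0 (negbTE fl) andbF => /eqP.
exists z; split=> //.
have [_ [w]] := Vq0; rewrite ec => /zM; rewrite rmorphB rmorphM /= map_polyC.
rewrite hornerD hornerN hornerM hornerC => /eqP; rewrite subr_eq0 => /eqP e'.
by apply: contra fc => /eqP fv; rewrite e' fv mul0r.
Qed.
End Extension.

Section Nullstellensatz.
Variable k : fieldType.
Hypothesis char0 : [pchar k] =i pred0.
Hypothesis kclosed : GRing.closed_field_axiom k.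

Lemma comap_prime (D B : comNzRingType) (g : {rmorphism D -> B}) (m : B -> Prop) :
  is_prime m -> is_prime (fun x => m (g x)).
Proof.
move=> pm; have idm := prime_ideal pm; split.
- split; first by rewrite rmorph0; apply: ideal0.
    by move=> x y mx my; rewrite rmorphD; apply: idealD.
  by move=> a x mx; rewrite rmorphM; apply: idealMl.
- by rewrite rmorph1; apply: prime1.
- by move=> x y; rewrite rmorphM; apply: primeM.
Qed.

(** One variable is adjoined to D for each element of s. Keeping polynomial rings with maps to B,
    and pulling m back along them, avoids forming subrings and quotients of B. *)
Lemma extend_hom_seq (B : comNzRingType) (m : B -> Prop) (s : seq B) :
  is_prime m -> (forall b, b \in s -> ~ m b) ->
  forall (D : comNzRingType) (g : {rmorphism D -> B}),
  exists u : D, ~ m (g u) /\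
  forall f : {rmorphism D -> k}, (forall x, m (g x) -> f x = 0) -> f u != 0 ->
  exists (D' : comNzRingType) (g' : {rmorphism D' -> B}) (j : {rmorphism D -> D'})
    (f' : {rmorphism D' -> k}),
    [/\ forall x, g' (j x) = g x, forall x, f' (j x) = f x,
        forall x, m (g' x) -> f' x = 0 &
        forall b, b \in s -> exists x, g' x = b /\ f' x != 0].
Proof.
move=> pm; elim: s => [|b s IH] ms D g.
  exists 1; rewrite rmorph1; split; first exact: prime1.
  by move=> f fm _; exists D, g, idfun, f.
have {}IH := IH (fun c hc => ms c (@mem_behead _ (b :: s) c hc)).
pose gb := [the {rmorphism {poly D} -> B} of horner_eval b \o map_poly g].
have gbX : gb 'X = b by rewrite /= /horner_eval map_polyX hornerX.
have [u' [mu' hu']] := IH {poly D} gb.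
(* The factor u' keeps the condition of the later extensions satisfied, and 'X makes the value z at
   b nonzero. *)
have mX : ~ m (gb (u' * 'X)).
  by rewrite rmorphM gbX => /(primeM pm)[|/(ms _ (mem_head _ _))].
have [u [mu hu]] := extend_hom char0 kclosed (comap_prime gb pm) mX.
have gbC x : gb x%:P = g x by rewrite /= /horner_eval map_polyC hornerC.
exists u; split; first by rewrite -gbC.
move=> f fm fu; have [|z [zm]] := hu f _ fu.
  by move=> x; rewrite gbC; apply: fm.
rewrite rmorphM /= map_polyX hornerM hornerX mulf_eq0 negb_or => /andP[zu z0].
pose fz := [the {rmorphism {poly D} -> k} of horner_eval z \o map_poly f].
have [|D' [g' [j [f' [g'j f'j f'm im]]]]] := hu' fz _ zu.
  by move=> x /zm.
exists D', g', [the {rmorphism D -> D'} of j \o polyC], f'; split=> //.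
- by move=> x; rewrite /= g'j gbC.
- by move=> x; rewrite /= f'j /= /horner_eval map_polyC hornerC.
- move=> c; rewrite inE => /orP[/eqP ->|/im//].
  by exists (j 'X); rewrite g'j gbX f'j /= /horner_eval map_polyX hornerX.
Qed.

Lemma rmorph_meval n (D : comNzRingType) (j : {rmorphism k -> D})
    (f : {rmorphism D -> k}) (x : 'I_n -> D) (p : {mpoly k[n]}) :
  (forall c, f (j c) = c) -> f (mmap j x p) = p.@[fun i => f (x i)].
Proof.
move=> fj; rewrite /meval /mmap rmorph_sum; apply: eq_bigr => m _.
rewrite rmorphM fj /mmap1 rmorph_prod; congr (_ * _).
by apply: eq_bigr => i _; rewrite rmorphXn.
Qed.

Lemma rmorph_mmap n (D : comNzRingType) (j : {rmorphism k -> D})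
    (g : {rmorphism D -> {mpoly k[n]}}) (x : 'I_n -> D) (p : {mpoly k[n]}) :
  (forall c, g (j c) = c%:MP) -> (forall i, g (x i) = 'X_i) -> g (mmap j x p) = p.
Proof.
move=> gj gx; rewrite /mmap rmorph_sum [RHS]mpolyE; apply: eq_bigr => m _.
rewrite rmorphM gj mul_mpolyC /mmap1 rmorph_prod [in RHS]mpolyXE_id; congr (_ *: _).
by apply: eq_bigr => i _; rewrite rmorphXn gx.
Qed.

(** A prime ideal over J avoiding the powers of the product of the variables contains no variable;
    the identity of k extends along the variables, and their values form the zero. *)
Theorem torus_nullstellensatz n (J : {mpoly k[n]} -> Prop) :
  is_ideal J -> (forall r, ~ J ((\prod_(i < n) 'X_i) ^+ r)) ->
  exists a : 'I_n -> k,
    (forall i, a i != 0) /\ (forall p, J p -> p.@[a] = 0).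
Proof.
move=> idJ Jv; have [m [pm Jm mv]] := exists_prime idJ Jv.
pose s := [seq ('X_i : {mpoly k[n]}) | i <- enum 'I_n].
have ms b : b \in s -> ~ m b.
  move=> /mapP[i _ ->] mi; apply: mv; rewrite (bigD1 i) //=.
  by apply: idealMr => //; apply: prime_ideal.
have [u [mu hu]] := extend_hom_seq pm ms (@mpolyC n k).
have idm := prime_ideal pm.
have mC c : m c%:MP -> c = 0.
  move=> mc; apply/eqP; apply: contrapT => /negP c0; apply: (prime1 pm).
  have -> : 1 = (c^-1)%:MP * c%:MP :> {mpoly k[n]} by rewrite -mpolyCM mulVf.
  exact: idealMl.
have [||D [g [j [f [gj fj fm im]]]]] := hu idfun.
- by move=> c /mC.
- by apply: contra_notN mu => /eqP /= ->; rewrite mpolyC0; apply: ideal0.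
have imX i : exists x, g x = 'X_i /\ f x != 0.
  by apply: im; apply: map_f; rewrite mem_enum.
pose x i := xget 0 [set y | g y = 'X_i /\ f y != 0]%classic.
have xP i : g (x i) = 'X_i /\ f (x i) != 0.
  have [y hy] := imX i.
  by apply: (@xgetPex _ 0 [set y | g y = 'X_i /\ f y != 0]%classic); exists y.
exists (fun i => f (x i)); split=> [i|p Jp]; first by have [] := xP i.
(* The lift [mmap j x p] of p to D is mapped to p by g, hence into m, and to the value of p at the
   point by f. *)
rewrite -(rmorph_meval x p fj); apply: fm; rewrite rmorph_mmap //; first exact: Jm.
by move=> i; have [] := xP i.
Qed.
End Nullstellensatz.

(** * Graded modules *)

Section GmodTheory.
Variable k : fieldType.

Section Act.
Variable M : gmod k.
Local Arguments gcar : simpl never.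
Local Arguments act : simpl never.

Lemma act0r x i j : act x j (0 : M i) = 0.
Proof.
have := act_lin x j (-1) (0 : M i) 0.
by rewrite scaler0 addr0 scaleN1r addNr.
Qed.

Lemma actDr x i j (u v : M i) : act x j (u + v) = act x j u + act x j v.
Proof. by have := act_lin x j 1 u v; rewrite !scale1r. Qed.

Lemma actZr x i j a (u : M i) : act x j (a *: u) = a *: act x j u.
Proof. by have := act_lin x j a u 0; rewrite act0r !addr0. Qed.

Lemma act_sumr x i j I (r : seq I) (P : pred I) (u : I -> M i) :
  act x j (\sum_(n <- r | P n) u n) = \sum_(n <- r | P n) act x j (u n).
Proof.
elim/big_rec2: _ => [|n u1 u2 _ <-]; first exact: act0r.
exact: actDr.
Qed.

Lemma act_swap x y i i' j l (v : M i) : i' = i + (l - j) ->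
  act x l (act y j v)
  = (br x y).1%:~R *: act (br x y).2 l v + act y l (act x i' v).
Proof. by move=> ->; rewrite -(act_br x y j l v) subrK. Qed.

Lemma submod_sum (N : submod M) i I (r : seq I) (P : pred I) (u : I -> M i) :
  (forall n, P n -> N i (u n)) -> N i (\sum_(n <- r | P n) u n).
Proof.
move=> hu; elim/big_rec: _ => [|n v Pn hv]; first exact: smem0.
by apply: smemD => //; apply: hu.
Qed.

Lemma submodB (N : submod M) i (u v : M i) : N i u -> N i v -> N i (u - v).
Proof. by move=> hu hv; apply: smemD => //; rewrite -scaleN1r; apply: smemZ. Qed.

(** The operator h(0) - (c - 2m) kills the m-th summand and multiplies the n-th one by 2(m - n),
    which is nonzero for n < m. *)
Lemma weight_sep (char0 : [pchar k] =i pred0) (c : k) (N : submod M) i m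
    (u : nat -> M i) :
  (forall n, act H i (u n) = (c - n.*2%:R) *: u n) -> N i (\sum_(n < m) u n) ->
  forall n, (n < m)%N -> N i (u n).
Proof.
elim: m u => // m IH u hu hN.
have hlt n : (n < m)%N -> N i (u n).
  move=> lnm; pose u' n := (m.*2%:R - n.*2%:R : k) *: u n.
  have : N i (u' n).
    apply: IH lnm; first by move=> r; rewrite actZr hu !scalerA mulrC.
    have -> : \sum_(n < m) u' n = act H i (\sum_(n < m.+1) u n)
        + (m.*2%:R - c) *: \sum_(n < m.+1) u n.
      rewrite act_sumr scaler_sumr -big_split big_ord_recr /= hu -scalerDl.
      rewrite addrC addrA subrK subrr scale0r add0r.
      apply: eq_bigr => r _; rewrite hu -scalerDl; congr (_ *: _).
      by ring.
    by apply: smemD; [apply: smem_act | apply: smemZ].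
  move=> /(smemZ (m.*2%:R - n.*2%:R)^-1); rewrite /u' scalerA mulVf ?scale1r //.
  rewrite -natrB ?leq_double; last exact: ltnW.
  move/pcharf0P: char0 => ->; rewrite -doubleB double_eq0.
  by rewrite subn_eq0 -ltnNge.
move=> n; rewrite ltnS leq_eqVlt => /orP[/eqP ->|]; last exact: hlt.
have -> : u m = \sum_(n < m.+1) u n - \sum_(n < m) u n.
  by rewrite big_ord_recr /= addrAC subrr add0r.
by apply: submodB => //; apply: submod_sum => j _; apply: hlt.
Qed.

Definition gzero : submod M.
Proof.
exists (fun i v => v = 0) => //.
- by move=> i u v -> ->; rewrite addr0.
- by move=> i a v ->; rewrite scaler0.
- by move=> x i j v ->; rewrite act0r.
Defined.

Section Generated.
Variables (d : int) (z0 : M d).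

Inductive gen_mem : forall i, M i -> Prop :=
| gen_base : gen_mem z0
| gen_act x i j (v : M i) : gen_mem v -> gen_mem (act x j v)
| gen_0 i : gen_mem (0 : M i)
| gen_lin i a (u v : M i) : gen_mem u -> gen_mem v -> gen_mem (a *: u + v).

Definition gen : submod M.
Proof.
exists gen_mem.
- exact: gen_0.
- by move=> i u v hu hv; rewrite -[u]scale1r; apply: gen_lin.
- by move=> i a v hv; rewrite -[_ *: _]addr0; apply: gen_lin => //; apply: gen_0.
- by move=> x i j v; apply: gen_act.
Defined.

(** U(H) z0, as opposed to U(g) z0 above. *)
Inductive hgen : forall i, M i -> Prop :=
| hgen_base : hgen z0
| hgen_act i j (v : M i) : hgen v -> hgen (act H j v)
| hgen_0 i : hgen (0 : M i)
| hgen_lin i a (u v : M i) : hgen u -> hgen v -> hgen (a *: u + v).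

Hypothesis char0 : [pchar k] =i pred0.
Variable c : k.
Hypothesis z0E : forall j, act E j z0 = 0.
Hypothesis z0H : act H d z0 = c *: z0.

Inductive flev : nat -> forall i, M i -> Prop :=
| flev_h i (v : M i) : hgen v -> flev 0 v
| flev_F n i j (v : M i) : flev n v -> flev n.+1 (act F j v)
| flev_0 n i : flev n (0 : M i)
| flev_lin n i a (u v : M i) : flev n u -> flev n v -> flev n (a *: u + v).

Lemma hgen_E i j (v : M i) : hgen v -> act E j v = 0.
Proof.
move=> h; elim: h j => {i v}.
- exact: z0E.
- by move=> i j v _ IH l; rewrite (act_swap _ _ _ erefl) !IH act0r scaler0 addr0.
- by move=> i j; rewrite act0r.
- by move=> i a u v _ IHu _ IHv j; rewrite act_lin IHu IHv scaler0 addr0.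
Qed.

Lemma hgen_h0 i (v : M i) : hgen v -> act H i v = c *: v.
Proof.
elim=> {i v}.
- exact: z0H.
- move=> i j v _ IH; rewrite (@act_swap _ _ _ i) ?subrr ?addr0 // IH actZr.
  by rewrite scale0r add0r.
- by move=> i; rewrite act0r scaler0.
- move=> i a u v _ IHu _ IHv; rewrite act_lin IHu IHv scalerDr.
  by rewrite !scalerA mulrC.
Qed.

Lemma flev_H n i j (v : M i) : flev n v -> flev n (act H j v).
Proof.
move=> h; elim: h j => {n i v}.
- by move=> i v hv j; apply/flev_h/hgen_act.
- move=> n i j v hv IH l; rewrite (act_swap _ _ _ erefl).
  by apply: flev_lin; apply: flev_F.
- by move=> n i j; rewrite act0r; apply: flev_0.
- by move=> n i a u v _ IHu _ IHv j; rewrite act_lin; apply: flev_lin.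
Qed.

Lemma flev_E n i j (v : M i) :
  flev n v -> if n is n'.+1 then flev n' (act E j v) else act E j v = 0.
Proof.
move=> h; elim: h j => {n i v}.
- by move=> i v hv j; apply: hgen_E.
- move=> n i j v hv IH l; rewrite (act_swap _ _ _ erefl).
  apply: flev_lin; first exact: flev_H.
  case: n hv IH => [|n] hv IH; last exact/flev_F/IH.
  by rewrite IH act0r; apply: flev_0.
- by move=> [|n] i j; rewrite act0r //; apply: flev_0.
- move=> [|n] i a u v _ IHu _ IHv j; rewrite act_lin; last exact: flev_lin.
  by rewrite IHu IHv scaler0 addr0.
Qed.

Lemma flev_h0 n i (v : M i) : flev n v -> act H i v = (c - n.*2%:R) *: v.
Proof.
elim=> {n i v}.
- by move=> i v /hgen_h0 ->; rewrite subr0.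
- move=> n i j v _ IH; rewrite (@act_swap _ _ _ i) ?subrr ?addr0 //=.
  rewrite IH actZr -scalerDl; congr (_ *: _).
  by rewrite doubleS -[n.*2.+2]addn2 natrD; ring.
- by move=> n i; rewrite act0r scaler0.
- move=> n i a u v _ IHu _ IHv; rewrite act_lin IHu IHv scalerDr.
  by rewrite !scalerA mulrC.
Qed.

(** For z0 killed by E, e(l) lowers, h(l) preserves and f(l) raises the level by one, so the sums of
    levels form a submodule. Allowing every large m makes two such sums easy to add. *)
Lemma gen_flev i (v : M i) : gen i v ->
  exists u m0, (forall n, flev n (u n)) /\
    forall m, (m0 <= m)%N -> v = \sum_(n < m) u n.
Proof.
elim=> {i v}.
- exists (fun n => if n is 0 then z0 else 0), 1%N; split.
    by case=> [|n]; [apply/flev_h/hgen_base | apply: flev_0].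
  by case=> [//|m] _; rewrite big_ord_recl /= big1 ?addr0.
- move=> x i j v _ [u [m0 [hu hm0]]]; case: x.
  + exists (fun n => act E j (u n.+1)), m0; split.
      by move=> n; apply: (flev_E _ (hu n.+1)).
    move=> m lm; rewrite (hm0 m.+1 (leqW lm)) act_sumr big_ord_recl.
    by rewrite (flev_E _ (hu 0%N)) add0r.
  + exists (fun n => act H j (u n)), m0; split; first by move=> n; apply: flev_H.
    by move=> m lm; rewrite (hm0 m lm) act_sumr.
  + exists (fun n => if n is n'.+1 then act F j (u n') else 0), m0.+1; split.
      by case=> [|n]; [apply: flev_0 | apply: flev_F].
    case=> [//|m] lm; rewrite (hm0 m lm) act_sumr big_ord_recl.
    by rewrite add0r.
- move=> i; exists (fun _ => 0), 0%N; split; first by move=> n; apply: flev_0.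
  by move=> m _; rewrite big1.
- move=> i a v w _ [u [m0 [hu hm0]]] _ [u' [m0' [hu' hm0']]].
  exists (fun n => a *: u n + u' n), (maxn m0 m0'); split.
    by move=> n; apply: flev_lin.
  move=> m; rewrite geq_max => /andP[l1 l2].
  by rewrite (hm0 m l1) (hm0' m l2) big_split scaler_sumr.
Qed.

(** Each f lowers the h(0)-weight by 2, so only level 0, which is U(H) z0, has weight c. *)
Lemma gen_top i (v : M i) : gen i v -> act H i v = c *: v -> hgen v.
Proof.
move=> /gen_flev[u [m0 [hu hm0]]] vH.
(* With v subtracted in level 0 the components sum to zero, and separation of weights in the zero
   submodule gives v = u_0. *)
pose u' n := if n is 0 then u 0%N - v else u n.
have h n : (n < m0.+1)%N -> gzero i (u' n).
  apply: (weight_sep char0 (c := c)).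
    case=> [|n']; last exact: (flev_h0 (hu n'.+1)).
    have -> : u' 0%N = (-1) *: v + u 0%N by rewrite scaleN1r addrC.
    rewrite act_lin vH (flev_h0 (hu 0%N)) double0 subr0 scalerDr !scalerA.
    by rewrite mulrC.
  have := hm0 m0.+1 (leqnSn _); rewrite !big_ord_recl /= => ev.
  by rewrite addrAC -ev subrr.
have /eqP := h 0%N isT; rewrite subr_eq0 => /eqP <-.
have hg : forall n j (w : M j), flev n w -> n = 0%N -> hgen w.
  move=> n j w; elim=> {n j w} //.
  - by move=> n j _; apply: hgen_0.
  - by move=> n j a w w' _ IH _ IH' n0; apply: hgen_lin; [apply: IH | apply: IH'].
exact: hg (hu 0%N) _.
Qed.

End Generated.
End Act.
End GmodTheory.

(** * Isomorphisms, shifts and Goursat's lemma *)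

Section Morphisms.
Variable k : fieldType.
Implicit Types M : gmod k.
Local Arguments gcar : simpl never.
Local Arguments act : simpl never.

Lemma inj_surj_bij (T U : Type) (f : T -> U) :
  injective f -> (forall u, exists t, f t = u) -> bijective f.
Proof.
by move=> fI /choice[g fK]; exists g => // t; apply: fI; rewrite fK.
Qed.

(** Allows target degrees that equal i + d only propositionally, such as i or i + d + e. *)
Lemma iso_along M M' (s : int -> int) d (f : forall i, M i -> M' (s i)) :
  (forall i, s i = i + d) -> (forall i, linear (f i)) ->
  (forall i, bijective (f i)) ->
  (forall x i j (v : M i), f j (act x j v) = act x (s j) (f i v)) ->
  iso M M'.
Proof.
move=> hs; have es : s = fun i => i + d by apply: funext.
subst s; clear hs => flin fbij fact.
by exists d, f.
Qed.

Lemma iso_deg0 M M' (f : forall i, M i -> M' i) :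
  (forall i, linear (f i)) -> (forall i, bijective (f i)) ->
  (forall x i j (v : M i), f j (act x j v) = act x j (f i v)) ->
  iso M M'.
Proof. by move=> *; apply: (@iso_along _ _ id 0 f) => // i; rewrite addr0. Qed.

Lemma iso_trans M1 M2 M3 : iso M1 M2 -> iso M2 M3 -> iso M1 M3.
Proof.
move=> [d [f [flin fbij fact]]] [e [g [glin gbij gact]]].
apply: (@iso_along _ _ (fun i => i + d + e) (d + e) (fun i v => g _ (f i v))).
- by move=> i; rewrite addrA.
- by move=> i a u v; rewrite flin glin.
- by move=> i; apply: bij_comp.
- by move=> x i j v; rewrite fact gact.
Qed.

Lemma iso_irreducible M M' : iso M M' -> irreducible M -> irreducible M'.
Proof.
move=> [d [f [flin fbij fact]]] [[i [v v0]] Mirr].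
have f0 j : f j 0 = 0.
  by have := flin j (-1) 0 0; rewrite scaler0 addr0 !scaleN1r addNr.
split.
  by exists (i + d), (f i v) => fv; apply: v0; apply: (bij_inj (fbij i)); rewrite fv f0.
move=> N.
unshelve (epose (N' := @SubMod k M (fun i u => N (i + d) (f i u)) _ _ _ _)).
  - by move=> j /=; rewrite f0; apply: smem0.
  - move=> j u w hu hw /=; rewrite -[u]scale1r flin scale1r.
    exact: smemD.
  - move=> j a u hu /=; rewrite -[a *: u]addr0 flin f0 addr0; exact: smemZ.
  - by move=> x j l u hu /=; rewrite fact; apply: smem_act.
have onto (Q : forall j, M' j -> Prop) :
    (forall i u, Q (i + d) (f i u)) -> forall j w, Q j w.
  move=> h j; rewrite -[j](subrK d) => w.
  by have [g _ gK] := fbij (j - d); rewrite -[w]gK.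
have [h|h] := Mirr N'; [left|right]; apply: onto => j u; last exact: h.
by move=> /h ->.
Qed.

Definition shift (d : int) M : gmod k.
Proof.
refine (@GMod k (fun i => M (i + d)) (fun x i j v => act x (j + d) v) _ _).
- by move=> x i j; apply: act_lin.
- move=> x y i j l v; rewrite -(act_br x y (j + d) (l + d) v).
  by have -> : i + d + (l + d - (j + d)) = i + (l - j) + d by ring.
Defined.

Lemma shift_iso d M : iso M (shift d M).
Proof.
exists (- d); rewrite /shift /=.
(* Abstracting the degree map lets the equation s = id be rewritten, after which the identity is the
   required map. *)
pose s i := i - d + d.
have es : s = id by apply: funext => i; rewrite /s subrK.
suff : exists f : forall i, M i -> M (s i),
  [/\ forall i, linear (f i), forall i, bijective (f i) &
      forall x i j (v : M i), f j (act x j v) = act x (s j) (f i v)] by [].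
rewrite es; exists (fun i v => v); split=> // i; exact: inv_bij.
Qed.

Definition prodg M M' : gmod k.
Proof.
refine (@GMod k (fun i => (M i * M' i)%type)
  (fun x i j z => (act x j z.1, act x j z.2)) _ _).
- by move=> x i j a u v /=; rewrite !act_lin.
- move=> x y i j l v /=.
  by congr (_, _) => /=; apply: act_br.
Defined.

Lemma prodgD M M' i (u u' : M i) (v v' : M' i) :
  ((u, v) : prodg M M' i) + (u', v') = (u + u', v + v').
Proof. by []. Qed.

Lemma prodgB M M' i (u u' : M i) (v v' : M' i) :
  ((u, v) : prodg M M' i) - (u', v') = (u - u', v - v').
Proof. by []. Qed.

Lemma prodgZ M M' i a (u : M i) (v : M' i) :
  a *: ((u, v) : prodg M M' i) = (a *: u, a *: v).
Proof. by []. Qed.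

Lemma prodg_act M M' x i j (u : M i) (v : M' i) :
  act x j ((u, v) : prodg M M' i) = (act x j u, act x j v).
Proof. by []. Qed.

(* Goursat's lemma for the submodule X of C + L generated by (T w, y). *)
Section Goursat.
Variables (M C L : gmod k) (T : forall i, M i -> C i).
Hypothesis Tlin : forall i, linear (T (i := i)).
Hypothesis Tact : forall x i j (v : M i), T (act x j v) = act x j (T v).
Variables (d : int) (w : M d) (y : L d).
Hypothesis Lirr : irreducible L.
Hypothesis y0 : y <> 0.
Let X := gen ((T w, y) : prodg C L d).
Hypothesis Xy : ~ X d (0, y).

Lemma hom0 i : T (0 : M i) = 0.
Proof. by have := Tlin (-1) (0 : M i) 0; rewrite scaler0 addr0 !scaleN1r addNr. Qed.

Lemma homZ i a (u : M i) : T (a *: u) = a *: T u.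
Proof. by have := Tlin a u 0; rewrite hom0 !addr0. Qed.

Lemma homD i (u v : M i) : T (u + v) = T u + T v.
Proof. by have := Tlin 1 u v; rewrite !scale1r. Qed.

Lemma homB i (u v : M i) : T (u - v) = T u - T v.
Proof. by rewrite homD -scaleN1r homZ scaleN1r. Qed.

(** These l form a submodule of L that does not contain y, so it is zero by irreducibility. *)
Lemma goursat_inj i (l : L i) : X i (0, l) -> l = 0.
Proof.
unshelve (epose (K := @SubMod k L (fun i l => X i (0, l)) _ _ _ _)).
  - by move=> j; apply: (smem0 X).
  - by move=> j u v hu hv; have := smemD hu hv; rewrite prodgD addr0.
  - by move=> j a u hu; have := smemZ a hu; rewrite prodgZ scaler0.
  - by move=> x j l' u hu; have := smem_act x l' hu; rewrite prodg_act act0r.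
have [h|h] := Lirr.2 K; first exact: h.
by case: Xy; apply: (h d y).
Qed.

Lemma goursat_onto i (l : L i) : exists m, X i (T m, l).
Proof.
unshelve (epose (R := @SubMod k L (fun i l => exists m, X i (T m, l)) _ _ _ _)).
  - by move=> j; exists 0; rewrite hom0; apply: (smem0 X).
  - move=> j u v [m hm] [m' hm']; exists (m + m'); rewrite homD.
    exact: (smemD hm hm').
  - by move=> j a u [m hm]; exists (a *: m); rewrite homZ; apply: (smemZ a hm).
  - move=> x j l' u [m hm]; exists (act x l' m); rewrite Tact.
    exact: (smem_act x l' hm).
have [h|h] := Lirr.2 R; last exact: h.
by case: y0; apply: h; exists w; apply: gen_base.
Qed.

(** N is the preimage under T of the first projection of X, and P the preimage of its part with
    second component 0; X induces the isomorphism between L and N/P. *)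
Theorem goursat_subquotient : subquotient L M.
Proof.
unshelve (epose (N := @SubMod k M (fun i m => exists l, X i (T m, l)) _ _ _ _)).
  - by move=> j; exists 0; rewrite hom0; apply: (smem0 X).
  - move=> j u v [m hm] [m' hm']; exists (m + m'); rewrite homD.
    exact: (smemD hm hm').
  - by move=> j a u [m hm]; exists (a *: m); rewrite homZ; apply: (smemZ a hm).
  - move=> x j l' u [m hm]; exists (act x l' m); rewrite Tact.
    exact: (smem_act x l' hm).
unshelve (epose (P := @SubMod k M (fun i m => X i (T m, 0)) _ _ _ _)).
  - by move=> j /=; rewrite hom0; apply: (smem0 X).
  - by move=> j u v hu hv; have := smemD hu hv; rewrite prodgD addr0 /= homD.
  - by move=> j a u hu; have := smemZ a hu; rewrite prodgZ scaler0 /= homZ.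
  - by move=> x j l' u hu; have := smem_act x l' hu; rewrite prodg_act act0r /= Tact.
exists N, P; split; first by move=> i m hm; exists 0.
(* An arbitrary choice of partners; two partners of the same l differ by an element of P. *)
pose g i (l : L i) : M i := sval (cid (goursat_onto l)).
have hg i l : X i (T (g i l), l) by exact: (svalP (cid (goursat_onto l))).
have Ng i l : N i (g i l) by exists l.
have piE i (l : L i) (m : M i) (Nm : N i m) : X i (T m, l) ->
    subquot_pi P (Ng i l) = subquot_pi P Nm.
  move=> h; apply/subquot_pi_eq => /=; rewrite homB.
  by have := submodB (hg i l) h; rewrite prodgB subrr.
apply: (@iso_deg0 L (subquot N P) (fun i l => subquot_pi P (Ng i l))).
- move=> i a u v.
  have Nw : N i (a *: g i u + g i v).
    by exists (a *: u + v); rewrite Tlin; apply: (smemD (smemZ a (hg i u)) (hg i v)).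
  rewrite -(subquot_pi_lin P (Ng i u) (Ng i v) Nw); apply: piE.
  by rewrite Tlin; apply: (smemD (smemZ a (hg i u)) (hg i v)).
- move=> i; apply: inj_surj_bij.
    move=> l l' /subquot_pi_eq h; have {}h : X i (T (g i l - g i l'), 0) := h.
    apply/eqP; rewrite -subr_eq0; apply/eqP.
    apply: goursat_inj; have := submodB (submodB (hg i l) (hg i l')) h.
    by rewrite homB !prodgB subrr subr0.
  move=> q; have [m [Nm ->]] := subquot_piP q; have [l hl] := Nm.
  by exists l; apply: piE.
- move=> x i j l; rewrite (piE j _ _ (smem_act x j (Ng i l))).
    exact/esym/(subquot_actE P).
  rewrite Tact; exact: (smem_act x j (hg i l)).
Qed.

End Goursat.

(** By irreducibility of both factors, X meets each of them in zero and projects onto each, so it is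
    the graph of an isomorphism. *)
Theorem goursat_iso (S L : gmod k) d (v : S d) (y : L d) :
  irreducible S -> irreducible L -> v <> 0 -> y <> 0 ->
  ~ gen ((v, y) : prodg S L d) d (0, y) -> 
  exists f : forall i, S i -> L i,
   [/\ forall i, linear (f i), forall i, bijective (f i) &
       forall x i j (u : S i), f j (act x j u) = act x j (f i u)].
Proof.
move=> Sirr Lirr v0 y0 Xy; set X := gen _ in Xy.
have idlin i : linear (@id (S i)) by [].
have onto i (l : L i) : exists m, X i (m, l) by apply: (goursat_onto (T := fun i => id)).
have inj i (l : L i) : X i (0, l) -> l = 0 by apply: (goursat_inj (T := fun i => id)).
unshelve (epose (N := @SubMod k S (fun i m => X i (m, 0)) _ _ _ _)).
  - by move=> j; apply: (smem0 X).
  - by move=> j u u' hu hv; have := smemD hu hv; rewrite prodgD addr0.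
  - by move=> j a u hu; have := smemZ a hu; rewrite prodgZ scaler0.
  - by move=> x j l' u hu; have := smem_act x l' hu; rewrite prodg_act act0r.
have Xvy : X d (v, y) by apply: gen_base.
have inj' i (m : S i) : X i (m, 0) -> m = 0.
  have [h|h] := Sirr.2 N; first exact: h.
  case: Xy; have := submodB Xvy (h d v).
  by rewrite prodgB subrr subr0.
have total i (m : S i) : exists l, X i (m, l).
  unshelve (epose (R := @SubMod k S (fun i m => exists l, X i (m, l)) _ _ _ _)).
    - by move=> j; exists 0; apply: (smem0 X).
    - by move=> j u u' [l hl] [l' hl']; exists (l + l'); apply: (smemD hl hl').
    - by move=> j a u [l hl]; exists (a *: l); apply: (smemZ a hl).
    - by move=> x j l' u [l hl]; exists (act x l' l); apply: (smem_act x l' hl).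
  have [h|h] := Sirr.2 R; last exact: h.
  by case: v0; apply: h; exists y.
pose g i (m : S i) : L i := sval (cid (total i m)).
have hg i m : X i (m, g i m) by exact: (svalP (cid (total i m))).
have gE i m l : X i (m, l) -> g i m = l.
  move=> h; apply/eqP; rewrite -subr_eq0; apply/eqP; apply: inj.
  by have := submodB (hg i m) h; rewrite prodgB subrr.
exists g; split.
- by move=> i a u u'; apply: gE; apply: (smemD (smemZ a (hg i u)) (hg i u')).
- move=> i; apply: inj_surj_bij.
    move=> m m' e; apply/eqP; rewrite -subr_eq0; apply/eqP; apply: inj'.
    have := submodB (hg i m) (hg i m').
    by rewrite e prodgB subrr.
  by move=> l; have [m hm] := onto i l; exists m; apply: gE.
- by move=> x i j u; apply: gE; apply: (smem_act x j (hg i u)).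
Qed.

End Morphisms.

(** * Tensor products of evaluation modules *)

Section Oscillator.
Variables (k : fieldType) (n : nat).
Implicit Types p q : {mpoly k[n]}.

(* The Verma module of highest weight 0 in the i-th variable: f, h and e act as
   z, -2 z d/dz and -z (d/dz)^2. *)
Definition osc1 (x : sl2) (i : 'I_n) p : {mpoly k[n]} :=
  match x with
  | E => - ('X_i * p^`M(i)^`M(i))
  | H => - ('X_i * p^`M(i)) *+ 2
  | F => 'X_i * p
  end.

Lemma mderiv_X1 (i j : 'I_n) : ('X_j : {mpoly k[n]})^`M(i) = (i == j)%:R.
Proof.
rewrite mderivX mnm1E eq_sym; have [->|_] := eqVneq; last by rewrite scale0r.
have -> : (U_(j) - U_(j) = 0 :> 'X_{1.. n})%MM.
  by apply/mnmP => l; rewrite mnmBE mnm0E subnn.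
by rewrite mpolyX0 scale1r.
Qed.

Lemma osc1_lin x i : linear (osc1 x i).
Proof.
move=> a p q; case: x => /=; rewrite ?mderivD ?mderivZ ?mderivD ?mderivZ mulrDr.
- by rewrite opprD -scalerAr scalerN.
- by rewrite opprD mulrnDl -scalerAr -scalerN scalerMnr.
- by rewrite -scalerAr.
Qed.

Lemma osc1_br x y i p :
  osc1 x i (osc1 y i p) - osc1 y i (osc1 x i p)
  = (br x y).1%:~R *: osc1 (br x y).2 i p.
Proof.
have D1 : ('X_i : {mpoly k[n]})^`M(i) = 1 by rewrite mderiv_X1 eqxx.
have D2 q : (q *+ 2)^`M(i) = q^`M(i) *+ 2 by exact: mderivMn.
case: x; case: y => /=; rewrite ?subrr ?scale0r //;
  rewrite ?(mderivN, D2, mderivM, D1, mderivD, mul1r) /= ?scaler_int.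
all: ring.
Qed.

Lemma osc1_comm x y i j p : i != j ->
  osc1 x i (osc1 y j p) = osc1 y j (osc1 x i p).
Proof.
move=> ij.
have D1 : ('X_j : {mpoly k[n]})^`M(i) = 0 by rewrite mderiv_X1 (negbTE ij).
have D2 : ('X_i : {mpoly k[n]})^`M(j) = 0 by rewrite mderiv_X1 eq_sym (negbTE ij).
have D3 q l : (q *+ 2)^`M(l) = q^`M(l) *+ 2 by exact: mderivMn.
have cm q : q^`M(i)^`M(j) = q^`M(j)^`M(i) by exact: mderiv_comm.
by case: x; case: y => /=;
  rewrite ?(mderivN, D3, mderivM, D1, D2, mul0r, add0r, cm) /=; ring.
Qed.

Lemma osc1D x i : {morph osc1 x i : p q / p + q}.
Proof. by move=> p q; have := osc1_lin x i 1 p q; rewrite !scale1r. Qed.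

Lemma osc1_0 x i : osc1 x i 0 = 0.
Proof.
have := osc1_lin x i (-1) 0 0.
by rewrite scaler0 addr0 scaleN1r addNr.
Qed.

Lemma osc1Z x i a p : osc1 x i (a *: p) = a *: osc1 x i p.
Proof. by have := osc1_lin x i a p 0; rewrite osc1_0 !addr0. Qed.

(* The action of x(l) on the tensor product of n evaluation modules k[z_i], the
   i-th one at the point b_i. *)
Definition osc (b : 'I_n -> k) (x : sl2) (l : int) p :=
  \sum_i b i ^ l *: osc1 x i p.

Lemma osc_lin b x l : linear (osc b x l).
Proof.
move=> a p q; rewrite /osc scaler_sumr -big_split; apply: eq_bigr => i _ /=.
by rewrite osc1_lin scalerDr !scalerA mulrC.
Qed.

Lemma oscZ b x l a p : osc b x l (a *: p) = a *: osc b x l p.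
Proof.
rewrite /osc scaler_sumr; apply: eq_bigr => i _.
by rewrite osc1Z !scalerA mulrC.
Qed.

Lemma osc1_sum x i I (r : seq I) (u : I -> {mpoly k[n]}) :
  osc1 x i (\sum_(j <- r) u j) = \sum_(j <- r) osc1 x i (u j).
Proof. by elim/big_rec2: _ => [|j p q _ <-]; rewrite ?osc1_0 ?osc1D. Qed.

(** Operators in different variables commute, so only the diagonal terms of the double sums
    survive. *)
Lemma osc_br b x y l m p : (forall i, b i != 0) ->
  osc b x l (osc b y m p) - osc b y m (osc b x l p)
  = (br x y).1%:~R *: osc b (br x y).2 (l + m) p.
Proof.
move=> b0.
have oE x' y' l' m' : osc b x' l' (osc b y' m' p)
    = \sum_i \sum_j (b i ^ l' * b j ^ m') *: osc1 x' i (osc1 y' j p).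
  apply: eq_bigr => i _; rewrite osc1_sum scaler_sumr; apply: eq_bigr => j _.
  by rewrite osc1Z scalerA.
rewrite !oE [X in _ - X]exchange_big /= -sumrB scaler_sumr; apply: eq_bigr => i _.
rewrite -sumrB (bigD1 i) //= big1 ?addr0 => [|j ji]; last first.
  by rewrite osc1_comm 1?eq_sym // mulrC subrr.
by rewrite [b i ^ m * _]mulrC -scalerBr osc1_br scalerA mulrC -expfzDr // scalerA.
Qed.

Section OscModule.
Variables (P : Type) (b : P -> 'I_n -> k).
Hypothesis b0 : forall s i, b s i != 0.

(** A product over P of tensor products, so that a whole family of points is treated at once. Every
    degree carries the same space. *)
Definition oscm : gmod k.
Proof.
refine (@GMod k (fun _ => (P -> {mpoly k[n]}))
  (fun x i j u => fun s => osc (b s) x (j - i) (u s)) _ _).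
- by move=> x i j a u v; apply: funext => s; apply: osc_lin.
- move=> x y i j l v; apply: funext => s.
  transitivity (osc (b s) x (l - j) (osc (b s) y (j - i) (v s)) -
     osc (b s) y (j - i) (osc (b s) x (l - j) (v s))).
    have e1 : i + (l - j) - i = l - j by ring.
    have e2 : l - (i + (l - j)) = j - i by ring.
    rewrite -[LHS]/(osc (b s) x (l - j) (osc (b s) y (j - i) (v s)) -
      osc (b s) y (l - (i + (l - j))) (osc (b s) x (i + (l - j) - i) (v s))).
    by rewrite e1 e2.
  by rewrite osc_br // addrA subrK.
Defined.

Definition zprod : {mpoly k[n]} := \prod_i 'X_i.

Lemma zprodE i : zprod = 'X_i * \prod_(j | j != i) 'X_j.
Proof. by rewrite /zprod (bigD1 i). Qed.

Lemma zprod_neq0 : zprod != 0.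
Proof.
rewrite /zprod prodf_seq_neq0; apply/allP => j _ /=.
apply/eqP => /(congr1 (mcoeff U_(j))).
by rewrite mcoeffXU eqxx mcoeff0 => /eqP; rewrite oner_eq0.
Qed.

Lemma mderiv_prod i : (\prod_(j | j != i) 'X_j : {mpoly k[n]})^`M(i) = 0.
Proof.
elim/big_rec: _ => [|j p ji hp]; first by rewrite -mpolyC1 mderivC.
by rewrite mderivM hp mderiv_X1 eq_sym (negbTE ji) mul0r mulr0 addr0.
Qed.

Lemma mderiv_zprod i : zprod^`M(i) = \prod_(j | j != i) 'X_j.
Proof.
by rewrite (zprodE i) mderivM mderiv_prod mderiv_X1 eqxx mul1r mulr0 addr0.
Qed.

(** The monomial z_1 ... z_n is linear in every variable. *)
Lemma osc_E_zprod c l : osc c E l zprod = 0.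
Proof.
by apply: big1 => i _ /=; rewrite mderiv_zprod mderiv_prod mulr0 oppr0 scaler0.
Qed.

Lemma osc_H_zprod c l : osc c H l zprod = (- 2%:R * \sum_i c i ^ l) *: zprod.
Proof.
rewrite mulr_sumr scaler_suml; apply: eq_bigr => i _ /=.
rewrite mderiv_zprod -zprodE -scaler_nat scalerA.
by rewrite -scaleN1r scalerA; congr (_ *: _); ring.
Qed.

End OscModule.
End Oscillator.

(** * Irreducibility of L(phi) *)

Section HighestWeight.
Variable k : fieldType.
Hypothesis char0 : [pchar k] =i pred0.

(** Summing p(b_i) = 0 for p = prod (X - b_i), all terms but n p(0) would vanish, while p(0) is the
    product of the - b_i. *)
Lemma power_sum_neq0 n (b : 'I_n -> k) : (0 < n)%N -> (forall i, b i != 0) ->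
  exists j, (0 < j)%N /\ \sum_i b i ^+ j != 0.
Proof.
move=> n0 b0; apply: contrapT => h.
have {}h j : (0 < j)%N -> \sum_i b i ^+ j = 0.
  by move=> j0; apply/eqP; apply: contrapT => /negP hj; apply: h; exists j.
pose p : {poly k} := \prod_i ('X - (b i)%:P).
have pb i : p.[b i] = 0.
  apply/eqP; rewrite horner_prod prodf_seq_eq0; apply/hasP.
  by exists i; rewrite ?mem_index_enum //= hornerXsubC subrr.
have : \sum_i p.[b i] = 0 by apply: big1.
under eq_bigr do rewrite horner_coef.
rewrite exchange_big /=; under eq_bigr do rewrite -mulr_sumr.
have sp : size p = n.+1 by rewrite size_prod_XsubC /index_enum -enumT size_enum_ord.
rewrite sp big_ord_recl [X in _ + X]big1 ?addr0 => [|j _]; last by rewrite h ?mulr0.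
under eq_bigr do rewrite expr0; rewrite sumr_const card_ord => /eqP.
rewrite mulf_eq0 (negbTE (_ : n%:R != 0)); last first.
  by move/pcharf0P: char0 => ->; rewrite -lt0n.
rewrite orbF -horner_coef0 horner_prod prodf_seq_eq0 => /hasP[i _] /=.
by rewrite hornerXsubC sub0r oppr_eq0 (negbTE (b0 i)).
Qed.

Section Words.
Variable phi : int -> k.

Lemma W_word s : W_mem phi (\sum_(l <- s) l) (\prod_(l <- s) phi l).
Proof.
exists [:: (1, s)]; split; last by rewrite big_seq1 mul1r.
by move=> m; rewrite inE => /eqP ->.
Qed.

Lemma W_mem1 i : i = 0 -> W_mem phi i 1.
Proof. by move=> ->; have := W_word [::]; rewrite !big_nil. Qed.

Lemma W_mem_neq0 i c : W_mem phi i c -> c != 0 ->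
  exists s, \sum_(l <- s) l = i /\ \prod_(l <- s) phi l != 0.
Proof.
case=> u [hu ->] c0; apply: contrapT => h; case/eqP: c0.
rewrite big_seq; apply: big1 => m mu; have [->|p0] := eqVneq (\prod_(n <- m.2) phi n) 0.
  by rewrite mulr0.
by case: h; exists m.2; split=> //; apply: hu.
Qed.

Hypothesis phiE : Exp phi.

(** The word is h(-jl) h(l)^(j-1), where j is an exponent with nonzero power sum of the numbers
    a_i^(-l). *)
Lemma Exp_neg l : phi l != 0 ->
  exists s, \sum_(l <- s) l = - l /\ \prod_(l <- s) phi l != 0.
Proof.
have [n [a [a0 aphi]]] := phiE => pl.
have two : (2%:R : k) != 0 by move/pcharf0P: char0 => ->.
have n0 : (0 < n)%N.
  rewrite lt0n; apply: contra pl => /eqP n0; subst n.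
  by rewrite aphi big_ord0 mulr0.
have [j [j0 hj]] := power_sum_neq0 n0 (fun i => expfz_neq0 (- l) (a0 i)).
exists (- (l *+ j) :: nseq j.-1 l); rewrite !big_cons big_nseq -Monoid.iteropE.
split.
  rewrite [iterop _ _ _ _](_ : _ = l *+ j.-1) //.
  by rewrite -{1}(prednK j0) mulrS; ring.
rewrite mulf_neq0 //; last by rewrite big_nseq iter_mulr mulr1 expf_neq0.
rewrite aphi mulf_neq0 ?oppr_eq0 //.
rewrite (eq_bigr (fun i => (a i ^ (- l)) ^+ j)) // => i _.
by rewrite exprnP exprz_exp mulNr -[l *+ j]mulr_natr natz.
Qed.

Lemma word_neg s : \prod_(l <- s) phi l != 0 ->
  exists s', \sum_(l <- s') l = - \sum_(l <- s) l /\ \prod_(l <- s') phi l != 0.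
Proof.
elim: s => [|l s IH]; first by exists [::]; rewrite !big_nil oppr0 oner_neq0.
rewrite !big_cons mulf_eq0 negb_or => /andP[/Exp_neg[s1 [e1 p1]] /IH[s2 [e2 p2]]].
exists (s1 ++ s2); rewrite !big_cat /= e1 e2 opprD; split=> //.
by rewrite mulf_neq0.
Qed.

Section Submodule.
Variable N : submod (Ind (W phi)).

(** The vector c t^j of W(phi) lies in N. Stated for scalars, so that words in H act by
    multiplication without transport between degrees. *)
Definition top_coef j (c : k) : Prop :=
  exists cw : W phi j, W_val cw = c /\ N j (ind_in cw).

Lemma top_coef_act i j c : top_coef i c -> top_coef j (phi (j - i) * c).
Proof.
move=> [cw [<- h]]; exists (hact j cw); split=> //.
by rewrite -ind_in_H; apply: smem_act.
Qed.

Lemma top_coef_lin i a c c' : top_coef i c -> top_coef i c' -> top_coef i (a * c + c').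
Proof.
move=> [cw [<- h]] [cw' [<- h']]; exists (a *: cw + cw'); split=> //.
by rewrite ind_in_lin; apply: smemD => //; apply: smemZ.
Qed.

Lemma top_coef0 i : top_coef i 0.
Proof. by exists 0; split=> //; rewrite ind_in0; apply: smem0. Qed.

Lemma top_coef_word i c s j : top_coef i c -> j = i + \sum_(l <- s) l ->
  top_coef j (\prod_(l <- s) phi l * c).
Proof.
move=> h; elim: s j => [|l s IH] j; first by rewrite !big_nil addr0 mul1r => ->.
rewrite !big_cons -mulrA => ->.
have -> : phi l = phi (i + (l + \sum_(l <- s) l) - (i + \sum_(l <- s) l)).
  by congr phi; ring.
exact/top_coef_act/IH.
Qed.

(** A word of degree i with nonzero value exists, hence one of degree -i, which takes c t^i to a
    nonzero constant; 1 generates W(phi), and W(phi) generates the induced module. *)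
Lemma top_coef_full i c : top_coef i c -> c != 0 -> forall j (v : Ind (W phi) j), N j v.
Proof.
move=> h c0.
have one : top_coef 0 1.
  have [cw [ec _]] := h.
  have := asboolW (W_valP cw); rewrite ec => /W_mem_neq0/(_ c0)[s [es ps]].
  have [s' [es' ps']] := word_neg ps.
  have : top_coef 0 (\prod_(l <- s') phi l * c).
    by apply: top_coef_word h _; rewrite es' es addrN.
  set e := _ * c => he; have e0 : e != 0 by rewrite mulf_neq0.
  by have := top_coef_lin e^-1 he (top_coef0 _); rewrite mulVf // addr0.
have all j (cw : W phi j) : N j (ind_in cw).
  suff [cw' [e h']] : top_coef j (W_val cw) by rewrite -(val_inj e).
  have [u [hu ->]] := asboolW (W_valP cw).
  rewrite big_seq; elim/big_rec: _ => [|m x mu hx]; first exact: top_coef0.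
  apply: top_coef_lin => //; rewrite -[\prod_(_ <- _) _]mulr1.
  by apply: top_coef_word one _; rewrite add0r; apply/esym/hu.
apply: ind_ind => //.
- by move=> x i' j v hv; apply: smem_act.
- by move=> i' u v hu hv; apply: smemD.
- by move=> i' a v hv; apply: smemZ.
Qed.

End Submodule.

(** The equation is an argument so that 1 is also available in degrees such as d - d. *)
Definition Wone i (e : i = 0) : W phi i := WCar (asboolT (W_mem1 e)).

(** The vector z_1 ... z_n in the evaluation modules at a is killed by E and has the eigenvalues
    phi, so c t^i goes to c z_1 ... z_n under a homomorphism. *)
Lemma ind_Wone_neq0 i (e : i = 0) : ind_in (Wone e) <> 0.
Proof.
have [n [a [a0 aphi]]] := phiE.
pose C := oscm (P := unit) (b := fun _ => a) (fun _ => a0).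
pose f i (v : W phi i) : C i := fun _ => W_val v *: zprod k n.
have [|||g [[glin gact gin] _]] := @ind_univ _ (W phi) C f.
- move=> j c u v; apply: funext => s; rewrite /f /= scalerDl -scalerA.
  by [].
- move=> i' j v; apply: funext => s; rewrite /f /= oscZ osc_H_zprod -aphi.
  by rewrite scalerA mulrC.
- move=> i' j v; apply: funext => s; rewrite /f /= oscZ osc_E_zprod.
  by rewrite scaler0.
move=> e0; have := gin i (Wone e); rewrite e0.
have -> : g i 0 = 0 by have := glin i (-1) 0 0; rewrite scaler0 addr0 !scaleN1r addNr.
move/(congr1 (fun u => u tt)); rewrite /f /= scale1r => /esym/eqP.
exact/negP/zprod_neq0.
Qed.

Definition Lpi i (v : Ind (W phi) i) : Lphi phi i :=
  subquot_pi (Defs.rad (W phi)) (I : fullsub (Ind (W phi)) i v).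

Lemma Lpi_eq i (u v : Ind (W phi) i) : Lpi u = Lpi v <-> Defs.rad (W phi) i (u - v).
Proof. exact: subquot_pi_eq. Qed.

Lemma Lpi_onto i (q : Lphi phi i) : exists v, q = Lpi v.
Proof. by have [v [[] ->]] := subquot_piP q; exists v. Qed.

Lemma Lpi_lin i : linear (@Lpi i).
Proof. by move=> a u v; apply: subquot_pi_lin. Qed.

Lemma Lpi0 i : Lpi (0 : Ind (W phi) i) = 0.
Proof.
by have := Lpi_lin (-1) (0 : Ind (W phi) i) 0; rewrite scaler0 addr0 !scaleN1r addNr.
Qed.

Lemma Lpi_act x i j (v : Ind (W phi) i) : Lpi (act x j v) = act x j (Lpi v).
Proof. exact/esym/(subquot_actE _ (I : fullsub (Ind (W phi)) i v)). Qed.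

Lemma Lpi_top_inj i (e : i = 0) : Lpi (ind_in (Wone e)) <> 0.
Proof.
rewrite -(Lpi0 i) => /Lpi_eq; rewrite subr0.
move/(rad_meets_trivially char0 (@W_h0 _ phi)); exact: ind_Wone_neq0.
Qed.

(** The image of c t^i in L(phi); a relation, because c t^i must belong to W(phi). *)
Definition Ltop i (c : k) (l : Lphi phi i) : Prop :=
  exists cw : W phi i, W_val cw = c /\ l = Lpi (ind_in cw).

Lemma Ltop_act i j c (l : Lphi phi i) :
  Ltop c l -> Ltop (phi (j - i) * c) (act H j l).
Proof.
by move=> [cw [<- ->]]; exists (hact j cw); rewrite -Lpi_act ind_in_H.
Qed.

Lemma Ltop_lin i a c c' (l l' : Lphi phi i) :
  Ltop c l -> Ltop c' l' -> Ltop (a * c + c') (a *: l + l').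
Proof.
move=> [cw [<- ->]] [cw' [<- ->]]; exists (a *: cw + cw'); split=> //.
by rewrite ind_in_lin Lpi_lin.
Qed.

Lemma Ltop_0 i : Ltop 0 (0 : Lphi phi i).
Proof. by exists 0; rewrite ind_in0 Lpi0. Qed.

Lemma Ltop_eq0 i (l : Lphi phi i) : Ltop 0 l -> l = 0.
Proof.
move=> [cw [cw0 ->]]; rewrite -Lpi0 -ind_in0; congr (Lpi (ind_in _)).
exact: val_inj.
Qed.

Lemma Ltop_E i j c (l : Lphi phi i) : Ltop c l -> act E j l = 0.
Proof. by move=> [cw [_ ->]]; rewrite -Lpi_act ind_in_E Lpi0. Qed.

Lemma Ltop_H i c (l : Lphi phi i) : Ltop c l -> act H i l = phi 0 *: l.
Proof.
move=> [cw [_ ->]]; rewrite -Lpi_act ind_in_H W_h0 -[_ *: cw]addr0 ind_in_lin.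
by rewrite ind_in0 Lpi_lin Lpi0 addr0.
Qed.

Lemma Ltop_one i (e : i = 0) : Ltop 1 (Lpi (ind_in (Wone e))).
Proof. by exists (Wone e). Qed.

Theorem Lphi_irreducible : irreducible (Lphi phi).
Proof.
split; first by exists 0, (Lpi (ind_in (Wone erefl))); apply: Lpi_top_inj.
move=> N.
unshelve (epose (N' := @SubMod k (Ind (W phi)) (fun i v => N i (Lpi v)) _ _ _ _)).
- by move=> i /=; rewrite Lpi0; apply: smem0.
- move=> i u v hu hv /=; rewrite -[u]scale1r Lpi_lin scale1r.
  exact: smemD.
- by move=> i a v hv /=; rewrite -[_ *: _]addr0 Lpi_lin Lpi0 addr0; apply: smemZ.
- by move=> x i j v hv /=; rewrite Lpi_act; apply: smem_act.
(* The preimage of N either meets W(phi) trivially, and lies in the radical, or contains a nonzero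
   vector of W(phi), and is everything. *)
have [tN|ntN] := pselect (meets_trivially N').
  left=> i q; have [v ->] := Lpi_onto q => Nv; rewrite -Lpi0; apply/Lpi_eq.
  by rewrite subr0; apply: (rad_max tN).
right=> i q; have [v ->] := Lpi_onto q.
suff : N' i v by [].
have [j [cw [Nw w0]]] : exists j (cw : W phi j), N' j (ind_in cw) /\ ind_in cw <> 0.
  apply: contrapT => h; apply: ntN => j cw Nw; apply: contrapT => w0.
  by apply: h; exists j, cw.
apply: (@top_coef_full N' j (W_val cw)); first by exists cw.
apply: contra_notN w0 => /eqP c0; rewrite -ind_in0; congr ind_in.
exact: val_inj.
Qed.
End Words.
End HighestWeight.

(** * L(phi) as a subquotient of M(0) *)

Section Words.
Variable k : fieldType.

(* f(s_1) ... f(s_r) u_0, which vanishes in degrees other than the sum of s. *)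
Fixpoint fword (s : seq int) (j : int) : M0 k j :=
  if s is l :: s' then act F j (fword s' (j - l))
  else ind_in (const_mx 1 : triv k j).

Definition fgen n (b : 'I_n -> k) l : {mpoly k[n]} := \sum_i b i ^ l *: 'X_i.

Lemma osc_F n (b : 'I_n -> k) l p : osc b F l p = fgen b l * p.
Proof. by rewrite mulr_suml; apply: eq_bigr => i _ /=; rewrite scalerAl. Qed.

Lemma osc_H1 n (b : 'I_n -> k) l : osc b H l 1 = 0.
Proof.
apply: big1 => i _ /=.
by rewrite -mpolyC1 mderivC mulr0 oppr0 mul0rn scaler0.
Qed.

Lemma osc_E1 n (b : 'I_n -> k) l : osc b E l 1 = 0.
Proof.
by apply: big1 => i _ /=; rewrite -mpolyC1 mderivC mderiv0 mulr0 oppr0 scaler0.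
Qed.

Section Theta.
Variables (n : nat) (P : Type) (b : P -> 'I_n -> k).
Hypothesis b0 : forall s i, b s i != 0.

Lemma M0_to_osc : exists g : forall i, M0 k i -> oscm b0 i,
  [/\ forall i, linear (g i),
      forall x i j (v : M0 k i), g j (act x j v) = act x j (g i v) &
      forall s j, \sum_(l <- s) l = j ->
        g j (fword s j) = fun t => \prod_(l <- s) fgen (b t) l].
Proof.
(* Sends u_0 to 1; outside degree 0 the sum is empty. *)
pose f i (v : triv k i) : oscm b0 i := fun _ => (\sum_j v ord0 j) *: 1.
have [|||g [[glin gact gin] _]] := @ind_univ _ (triv k) (oscm b0) f.
- move=> i a u v; apply: funext => t; rewrite /f.
  transitivity (a *: ((\sum_j u ord0 j) *: 1) + (\sum_j v ord0 j) *: 1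
    : {mpoly k[n]}); last by [].
  rewrite scalerA -scalerDl; congr (_ *: _); rewrite mulr_sumr -big_split.
  by apply: eq_bigr => j _; rewrite !mxE.
- move=> i j v; apply: funext => t.
  rewrite /f /= oscZ osc_H1 scaler0 /triv_act big1 ?scale0r // => l _.
  by rewrite mxE.
- by move=> i j v; apply: funext => t; rewrite /f /= oscZ osc_E1 scaler0.
exists g; split=> // s; elim: s => [|l s IH] j.
  rewrite big_nil => <-; rewrite /= gin /f; apply: funext => t.
  by rewrite big_nil big_ord1 mxE scale1r.
rewrite big_cons => ej; rewrite /= gact IH; last by rewrite -ej; ring.
apply: funext => t; rewrite /= osc_F big_cons.
by have -> : j - (j - l) = l by ring.
Qed.

End Theta.

Section Hankel.
Variable n : nat.

(* det[f(j - i)] u_0: in every tensor product of evaluation modules it becomes a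
   multiple of z_1 ... z_n, which the e(l) annihilate. *)
Definition fdet : M0 k 0 :=
  \sum_(s : 'S_n) (-1) ^+ s *: fword [seq (s i)%:Z - i%:Z | i <- enum 'I_n] 0.

Definition fdet_coef (b : 'I_n -> k) : k :=
  \det (Vandermonde n (\row_i (b i)^-1)) * \det (Vandermonde n (\row_i b i)).

(** The matrix is the Vandermonde matrix of the inverses, times the diagonal matrix of the z_i,
    times the transposed Vandermonde matrix of b. *)
Lemma det_fgen (b : 'I_n -> k) : (forall i, b i != 0) ->
  \det (\matrix_(i, j < n) fgen b (j%:Z - i%:Z)) = fdet_coef b *: zprod k n.
Proof.
move=> b0.
have -> : \matrix_(i, j < n) fgen b (j%:Z - i%:Z) =
    map_mx (@mpolyC n k) (Vandermonde n (\row_i (b i)^-1))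
    *m diag_mx (\row_i 'X_i) *m map_mx (@mpolyC n k) (Vandermonde n (\row_i b i))^T.
  apply/matrixP => i j; rewrite !mxE; apply: eq_bigr => a _.
  rewrite mul_mx_diag !mxE expfzDr // -exprnP exprVn -exprnN.
  by rewrite -!mul_mpolyC mpolyCM; ring.
rewrite !det_mulmx det_diag !det_map_mx det_tr /fdet_coef -mul_mpolyC mpolyCM.
rewrite mulrAC; congr (_ * _); apply: eq_bigr => i _; by rewrite mxE.
Qed.

Lemma sum_perm_sub (s : 'S_n) :
  \sum_(l <- [seq (s i)%:Z - i%:Z | i <- enum 'I_n]) l = 0 :> int.
Proof.
rewrite big_map big_enum /= sumrB [X in X - _](_ : _ = \sum_(i < n) i%:Z) ?subrr //.
by rewrite [RHS](reindex_inj (@perm_inj _ s)).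
Qed.

Lemma fdet_osc (P : Type) (b : P -> 'I_n -> k) (b0 : forall t i, b t i != 0)
    (g : forall i, M0 k i -> oscm b0 i) :
  (forall i, linear (g i)) ->
  (forall s j, \sum_(l <- s) l = j ->
        g j (fword s j) = fun t => \prod_(l <- s) fgen (b t) l) ->
  g 0 fdet = fun t => fdet_coef (b t) *: zprod k n.
Proof.
move=> glin gE; apply: funext => t; rewrite -det_fgen // /fdet.
have g0 : g 0 0 = 0.
  by have := glin 0 (-1) 0 0; rewrite scaler0 addr0 !scaleN1r addNr.
have -> : g 0 (\sum_(s : 'S_n) (-1) ^+ s *:
      fword [seq (s i)%:Z - i%:Z | i <- enum 'I_n] 0)
    = \sum_(s : 'S_n) (-1) ^+ s *:
      g 0 (fword [seq (s i)%:Z - i%:Z | i <- enum 'I_n] 0).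
  elim/big_rec2: _ => [|s x y _ <-]; first exact: g0.
  exact: glin.
transitivity (\sum_(s : 'S_n) (-1) ^+ s *:
  \prod_(l <- [seq (s i)%:Z - i%:Z | i <- enum 'I_n]) fgen (b t) l).
  elim/big_rec2: _ => [//|s x y _ <-].
  by rewrite gE ?sum_perm_sub.
apply: eq_bigr => s _; rewrite scaler_sign mulr_sign big_map big_enum /=.
by under [in RHS]eq_bigr do rewrite mxE.
Qed.

End Hankel.
End Words.

(** * Rational functions regular at 0 *)

Section Regular.
Variable k : fieldType.

(** Off the zeros of q, r is the rational function p/q, whose value at 0 is c; r(0) itself does not
    matter if k is infinite, as any q vanishing at the origin is excluded only for the fraction. *)
Definition regular (r : k -> k) (c : k) : Prop :=
  exists p q : {poly k}, [/\ q.[0] != 0, c = p.[0] / q.[0] &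
    forall t, q.[t] != 0 -> r t = p.[t] / q.[t]].

Lemma regular_const c : regular (fun _ => c) c.
Proof.
by exists c%:P, 1; split=> [||t _]; rewrite !hornerE ?oner_neq0 // divr1.
Qed.

Lemma regularD r r' c c' : regular r c -> regular r' c' ->
  regular (fun t => r t + r' t) (c + c').
Proof.
move=> [p [q [q0 -> rE]]] [p' [q' [q0' -> rE']]].
exists (p * q' + p' * q), (q * q'); split=> [||t]; rewrite !hornerE.
- by rewrite mulf_neq0.
- by rewrite addf_div.
- rewrite mulf_eq0 negb_or => /andP[qt qt'].
  by rewrite rE // rE' // addf_div.
Qed.

Lemma regularM r r' c c' : regular r c -> regular r' c' ->
  regular (fun t => r t * r' t) (c * c').
Proof.
move=> [p [q [q0 -> rE]]] [p' [q' [q0' -> rE']]].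
exists (p * p'), (q * q'); split=> [||t]; rewrite !hornerM.
- by rewrite mulf_neq0.
- by rewrite mulf_div.
- rewrite mulf_eq0 negb_or => /andP[qt qt'].
  by rewrite rE // rE' // mulf_div.
Qed.

Lemma regularV r c : c != 0 -> regular r c -> regular (fun t => (r t)^-1) c^-1.
Proof.
move=> c0 [p [q [q0 ec rE]]].
have p0 : p.[0] != 0.
  by apply: contra c0 => /eqP p0; rewrite ec p0 mul0r.
(* The extra factor q excludes the t at which r is unknown. *)
exists (q * q), (p * q); split=> [||t]; rewrite !hornerM.
- by rewrite mulf_neq0.
- by rewrite ec invf_div -mulf_div divff // mulr1.
- rewrite mulf_eq0 negb_or => /andP[pt qt].
  by rewrite rE // invf_div -mulf_div divff // mulr1.
Qed.

Lemma regular_sum I (s : seq I) (r : I -> k -> k) (c : I -> k) :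
  (forall i, regular (r i) (c i)) ->
  regular (fun t => \sum_(i <- s) r i t) (\sum_(i <- s) c i).
Proof.
move=> h; elim: s => [|i s IH].
  have -> : (fun t => \sum_(i <- [::]) r i t) = fun _ => 0.
    by apply: funext => t; rewrite big_nil.
  by rewrite big_nil; apply: regular_const.
have -> : (fun t => \sum_(j <- i :: s) r j t)
    = fun t => r i t + \sum_(j <- s) r j t.
  by apply: funext => t; rewrite big_cons.
by rewrite big_cons; apply: regularD.
Qed.

Lemma regular_exprz r c (l : int) : c != 0 -> regular r c ->
  regular (fun t => r t ^ l) (c ^ l).
Proof.
move=> c0 h.
have hn m : regular (fun t => r t ^+ m) (c ^+ m).
  elim: m => [|m IH]; first exact: regular_const.
  have -> : (fun t => r t ^+ m.+1) = fun t => r t * r t ^+ m.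
    by apply: funext => t; rewrite exprS.
  by rewrite exprS; apply: regularM.
case: l => m; first exact: hn.
by apply: regularV; [rewrite expf_neq0 | apply: hn].
Qed.

Hypothesis char0 : [pchar k] =i pred0.

(** A nonzero numerator would be nonzero at some t outside the zeros of q and of the denominator. *)
Lemma regular_eq0 r c (q : {poly k}) : regular r c -> q != 0 ->
  (forall t, q.[t] != 0 -> r t = 0) -> c = 0.
Proof.
move=> [p [q' [q0 -> rE]]] qn0 h.
suff -> : p = 0 by rewrite horner0 mul0r.
have q'n0 : q' != 0 by apply: contra q0 => /eqP ->; rewrite horner0.
apply/eqP; apply: contrapT => /negP p0.
have [|t] := @exists_nonroot k (p * q' * q) char0; first by rewrite !mulf_neq0.
rewrite /root !hornerE !mulf_eq0 !negb_or => /andP[/andP[pt q't] qt].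
have := rE t q't; rewrite h // => /esym/eqP.
by rewrite mulf_eq0 invr_eq0 (negbTE pt) (negbTE q't).
Qed.

End Regular.

Section PartOne.
Variable k : fieldType.
Hypothesis char0 : [pchar k] =i pred0.
Variables (n : nat) (a : 'I_n -> k).
Hypothesis a0 : forall i, a i != 0.

Definition line i : {poly k} := (a i)%:P + i%:R *: 'X.

(* A curve through a along which the coordinates are distinct for almost all t;
   the value 1 only serves to avoid zero coordinates. *)
Definition pert (t : k) (i : 'I_n) : k :=
  if (line i).[t] == 0 then 1 else (line i).[t].

Lemma pert_neq0 t i : pert t i != 0.
Proof. by rewrite /pert; case: ifPn => //; rewrite oner_neq0. Qed.

Lemma line0 i : (line i).[0] = a i.
Proof. by rewrite /line !hornerE ?mulr0 ?addr0. Qed.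

Lemma regular_pert i : regular (fun t => pert t i) (a i).
Proof.
(* The denominator excludes the t where the coordinate was replaced by 1. *)
exists (line i * line i), (line i); rewrite hornerM line0; split=> [||t h].
- exact: a0.
- by rewrite mulfK.
- by rewrite /pert (negbTE h) hornerM mulfK.
Qed.

(** Off its zeros the points of the curve have distinct nonzero coordinates; it is nonzero because
    the lines have distinct slopes. *)
Definition degen : {poly k} :=
  \prod_i line i * \prod_(i < n) \prod_(j < n | (i < j)%N) (line j - line i).

Lemma degen_neq0 : degen != 0.
Proof.
rewrite mulf_neq0 //; rewrite prodf_seq_neq0; apply/allP => i _ /=.
  by apply: contra (a0 i) => /eqP e; rewrite -line0 e horner0.
rewrite prodf_seq_neq0; apply/allP => j _; apply/implyP => ij.
apply/eqP => /(congr1 (fun p : {poly k} => p`_1)).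
rewrite /line !coefE /= !mulr1 !add0r -natrB ?(ltnW ij) // => /eqP.
by move/pcharf0P: char0 => ->; rewrite subn_eq0 leqNgt ij.
Qed.

Lemma fdet_coef_pert t : degen.[t] != 0 -> fdet_coef (pert t) != 0.
Proof.
rewrite hornerM mulf_eq0 negb_or !horner_prod !prodf_seq_neq0.
case/andP => /allP h1 /allP h2.
have pE i : pert t i = (line i).[t].
  by rewrite /pert (negbTE (h1 i (mem_index_enum i))).
have dist (i j : 'I_n) : (i < j)%N -> pert t j - pert t i != 0.
  move=> ij; have /= := h2 i (mem_index_enum i).
  rewrite horner_prod prodf_seq_neq0 => /allP/(_ j (mem_index_enum j)).
  by rewrite ij /= !pE hornerD hornerN.
rewrite /fdet_coef !det_Vandermonde mulf_neq0 //.
  rewrite prodf_seq_neq0; apply/allP => i _ /=.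
  rewrite prodf_seq_neq0; apply/allP => j _; apply/implyP => ij; rewrite !mxE.
  have := dist i j ij; rewrite !subr_eq0; apply: contra => /eqP e.
  by rewrite -[pert t j]invrK e invrK.
rewrite prodf_seq_neq0; apply/allP => i _ /=.
rewrite prodf_seq_neq0; apply/allP => j _; apply/implyP => ij; rewrite !mxE.
exact: dist.
Qed.

Variable phi : int -> k.
Hypothesis aphi : forall j : int, phi j = - 2%:R * \sum_(i < n) a i ^ j.
Let phiE : Exp phi. Proof. by exists n, a. Qed.

Theorem Lphi_subquotient : subquotient (Lphi phi) (M0 k).
Proof.
have [g [glin gact gE]] := M0_to_osc pert_neq0.
have gw := fdet_osc glin gE.
pose D t := fdet_coef (pert t).
pose y := Lpi (ind_in (Wone phi (erefl 0))).
have yT : Ltop 1 y := Ltop_one phi erefl.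
apply: (goursat_subquotient glin gact (w := fdet k n) (y := y)).
- exact: (Lphi_irreducible char0 phiE).
- exact: (Lpi_top_inj char0 phiE).
pose C := oscm pert_neq0; pose z0 : prodg C (Lphi phi) 0 := (g 0 (fdet k n), y).
(* Division of the first component by D gives r, and its value c at t = 0 is the coefficient of the
   second one. This is preserved by H since the eigenvalues of h(l) along the curve are regular with
   value phi(l). *)
pose V j (z : prodg C (Lphi phi) j) := exists r c,
  [/\ regular r c, Ltop c z.2 & z.1 = fun t => (r t * D t) *: zprod k n].
have V0 j : @V j 0.
  exists (fun _ => 0), 0; split; [exact: regular_const | exact: Ltop_0 |].
  by apply: funext => t; rewrite mul0r scale0r.
have Vz0 : V 0 z0.
  exists (fun _ => 1), 1; split=> //; first exact: regular_const.
  by rewrite /= gw; apply: funext => t; rewrite mul1r.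
have hV j z : hgen z0 z -> V j z.
  elim=> {j z} //.
  - move=> i j [u l] _ [r [c [hr /= hl hu]]].
    exists (fun t => - 2%:R * \sum_m pert t m ^ (j - i) * r t), (phi (j - i) * c).
    split; last first.
    + apply: funext => t; rewrite /= hu oscZ osc_H_zprod scalerA; congr (_ *: _).
      by rewrite -!mulr_suml; ring.
    + exact: Ltop_act.
    + rewrite aphi.
      have -> : (fun t => - 2%:R * \sum_m pert t m ^ (j - i) * r t)
        = fun t => (- 2%:R * \sum_m pert t m ^ (j - i)) * r t.
        by apply: funext => t; rewrite -mulr_suml mulrA.
      apply: regularM => //; apply: regularM; first exact: regular_const.
      apply: regular_sum => i0; apply: regular_exprz => //.
      exact: regular_pert.
  - move=> i b [u l] [u' l'] _ [r [c [hr /= hl hu]]] _ [r' [c' [hr' /= hl' hu']]].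
    exists (fun t => b * r t + r' t), (b * c + c'); split.
    + by apply: regularD => //; apply: regularM => //; apply: regular_const.
    + exact: Ltop_lin.
    + apply: funext => t; rewrite /= hu hu'.
      transitivity (b *: ((r t * D t) *: zprod k n) + (r' t * D t) *: zprod k n) => //.
      by rewrite scalerA -scalerDl; congr (_ *: _); ring.
move=> Xy.
have : hgen z0 ((0, y) : prodg C (Lphi phi) 0).
  apply: (gen_top char0 (c := phi 0)) Xy _.
  - move=> j; rewrite /z0 prodg_act (Ltop_E _ yT) gw; congr (_, _).
    by apply: funext => t; rewrite /= oscZ osc_E_zprod scaler0.
  - rewrite /z0 prodg_act prodgZ (Ltop_H yT) gw; congr (_, _).
    apply: funext => t; rewrite /= oscZ osc_H_zprod subrr aphi.
    rewrite (eq_bigr (fun i => a i ^ 0)) // scalerA mulrC -scalerA.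
    by [].
  - by rewrite prodg_act prodgZ act0r scaler0 (Ltop_H yT).
move=> /hV[r [c [hr /= hl hu]]].
(* Where [degen] is nonzero, D is nonzero, so r vanishes there. *)
have c0 : c = 0.
  apply: (regular_eq0 char0 hr degen_neq0) => t ht.
  have := congr1 (fun u => u t) hu; rewrite /= => /esym/eqP.
  rewrite scaler_eq0 (negbTE (zprod_neq0 k n)) orbF mulf_eq0.
  by rewrite (negbTE (fdet_coef_pert ht)) orbF => /eqP.
by apply: (Lpi_top_inj char0 phiE (e := erefl)); apply: Ltop_eq0; rewrite -c0.
Qed.
End PartOne.

(** * Irreducible subquotients of M(0) *)

Section Families.
Variable k : fieldType.
Local Arguments gcar : simpl never.
Local Arguments act : simpl never.

Lemma fword_swap a b s j : fword k (a :: b :: s) j = fword k (b :: a :: s) j.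
Proof.
rewrite /= (@act_swap _ _ F F _ (j - b)); last by ring.
rewrite scale0r add0r.
by have -> : j - a - b = j - b - a by ring.
Qed.

Lemma fword_move x s1 s2 j : fword k (s1 ++ x :: s2) j = fword k (x :: s1 ++ s2) j.
Proof.
elim: s1 j => [//|y s1 IH] j.
transitivity (fword k (y :: x :: (s1 ++ s2)) j); last exact: fword_swap.
by rewrite [LHS]/= IH.
Qed.

Lemma fword_perm s s' j : perm_eq s s' -> fword k s j = fword k s' j.
Proof.
elim: s s' j => [|x s IH] s' j; first by rewrite perm_sym => /perm_nilP ->.
move=> p; have xs : x \in s' by rewrite -(perm_mem p) mem_head.
case/splitPr: xs p => s1 s2; rewrite fword_move.
rewrite perm_sym perm_catC cat_cons perm_cons perm_catC perm_sym.
by move=> /IH e; rewrite [LHS]/= e.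
Qed.

Lemma fword_neq s j : \sum_(l <- s) l != j -> fword k s j = 0.
Proof.
elim: s j => [|l s IH] j.
  rewrite big_nil eq_sym => j0 /=; rewrite -ind_in0; congr ind_in.
  by apply/matrixP => x [y yj]; exfalso; move: yj; rewrite (negbTE j0).
rewrite big_cons => h; rewrite /= IH ?act0r //.
by apply: contra h => /eqP ->; rewrite addrC subrK.
Qed.

Definition bump_at n (i : 'I_n) (l : int) (e : 'I_n -> int) : 'I_n -> int :=
  fun x => if x == i then e x + l else e x.

(** As [h, f] = -2f and H kills u_0, h(l) replaces the factors f(m) by -2 f(m + l), one at a time.
    Distinct indices let [bump_at] change a single factor. *)
Lemma fword_H n (f : 'I_n -> int) (s : seq 'I_n) j j' : uniq s ->
  act H j' (fword k (map f s) j)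
  = - 2%:R *: \sum_(i <- s) fword k (map (bump_at i (j' - j) f) s) j'.
Proof.
elim: s j j' => [|x s IH] j j' /=.
  rewrite big_nil scaler0 => _; rewrite ind_in_H -ind_in0; congr ind_in.
case/andP => xs us.
have bx i : i \in s -> bump_at i (j' - j) f x = f x.
  by move=> si; rewrite /bump_at; case: eqP => // e; case/negP: xs; rewrite e.
have bs : map (bump_at x (j' - j) f) s = map f s.
  apply/eq_in_map => i si; rewrite /bump_at; case: eqP => // e.
  by case/negP: xs; rewrite -e.
rewrite (@act_swap _ _ H F _ (j' - f x)); last by ring.
rewrite big_cons scalerDr; congr (_ + _).
  have bxx : bump_at x (j' - j) f x = f x + (j' - j) by rewrite /bump_at eqxx.
  rewrite /= bs bxx.
  have -> : j' - (f x + (j' - j)) = j - f x by ring.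
  by [].
rewrite IH // actZr act_sumr; congr (_ *: _).
rewrite big_seq [RHS]big_seq; apply: eq_bigr => i si.
rewrite /= bx //.
by have -> : j' - f x - (j - f x) = j' - j by ring.
Qed.

(* M0 is in level n the space of symmetric Laurent polynomials in x_1, ..., x_n,
   f(l_1) ... f(l_n) u_0 being the symmetrization of x^l, and h(l) acting as -2
   times the power sum of exponent l. G j e stands for the component of degree j
   of the symmetrization of x^e g, for a fixed symmetric g. *)
Record sym_family n (G : forall j, ('I_n -> int) -> M0 k j) : Prop := SymFamily {
  fam_sym : forall j e (t : 'S_n), G j (e \o t) = G j e;
  fam_H : forall j j' e,
    act H j' (G j e) = - 2%:R *: \sum_i G j' (bump_at i (j' - j) e) }.

Hypothesis char0 : [pchar k] =i pred0.

Lemma natr_neq0 n : (0 < n)%N -> (n%:R : k) != 0.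
Proof. by move/pcharf0P: char0 => ->; rewrite -lt0n. Qed.

Lemma lev_words n d (m : M0 k d) : lev n m ->
  exists ts : seq (k * seq int),
    (forall u, u \in ts -> size u.2 = n /\ \sum_(l <- u.2) l = d) /\
    m = \sum_(u <- ts) u.1 *: fword k u.2 d.
Proof.
elim=> {n d m}.
- move=> i; have [->|i0] := eqVneq i 0 => v.
    exists [:: (v ord0 ord0, [::])]; split.
      by move=> u; rewrite inE => /eqP ->; rewrite big_nil.
    rewrite big_seq1 /= -[_ *: _]addr0 -(ind_in0 _ 0) -ind_in_lin; congr ind_in.
    by apply/rowP => x; rewrite !mxE mulr1 addr0 ord1.
  exists [::]; split=> //; rewrite big_nil -ind_in0; congr ind_in.
  by apply/matrixP => x [y yj]; exfalso; move: yj; rewrite (negbTE i0).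
- move=> n i j v _ [ts [hts ->]].
  exists [seq (u.1, (j - i) :: u.2) | u <- ts]; split.
    move=> _ /mapP[u /hts[su eu] ->] /=; rewrite su big_cons eu; split=> //.
    by ring.
  rewrite act_sumr big_map; apply: eq_bigr => u _ /=; rewrite actZr.
  by have -> : j - (j - i) = i by ring.
- by move=> n i; exists [::]; rewrite big_nil.
- move=> n i a u v _ [ts [hts ->]] _ [ts' [hts' ->]].
  exists ([seq (a * w.1, w.2) | w <- ts] ++ ts'); split.
    by move=> w; rewrite mem_cat => /orP[/mapP[w' /hts h ->]|/hts'].
  rewrite big_cat big_map scaler_sumr; congr (_ + _).
  by apply: eq_bigr => w _; rewrite scalerA.
Qed.

Lemma perm_enum_perm n (t : 'S_n) : perm_eq (map t (enum 'I_n)) (enum 'I_n).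
Proof.
apply: uniq_perm; rewrite ?enum_uniq //.
  by rewrite map_inj_uniq ?enum_uniq //; apply: perm_inj.
move=> i; rewrite mem_enum; apply/mapP; exists (t^-1%g i); rewrite ?mem_enum //.
by rewrite permKV.
Qed.

(** Write m as a combination of words, add e to the exponents of each word in every order, and
    average over the n! orders. At e = 0 all orders give the same word. *)
Lemma exists_family n d (m : M0 k d) : lev n m ->
  exists G, [/\ @sym_family n G, G d (fun _ => 0) = m &
    forall j, j != d -> G j (fun _ => 0) = 0].
Proof.
move=> /lev_words[ts [hts em]].
pose w (s : seq int) (t : 'S_n) (e : 'I_n -> int) :=
  [seq nth 0 s (t i) + e i | i <- enum 'I_n].
pose G j (e : 'I_n -> int) : M0 k j :=
  (n`!%:R)^-1 *: \sum_(u <- ts) u.1 *: \sum_(t : 'S_n) fword k (w u.2 t e) j.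
have G0 j : G j (fun _ => 0) = \sum_(u <- ts) u.1 *: fword k u.2 j.
  rewrite /G scaler_sumr big_seq [RHS]big_seq; apply: eq_bigr => u /hts[su _].
  rewrite (eq_bigr (fun _ => fword k u.2 j)) => [|t _].
    rewrite sumr_const card_Sn -scaler_nat !scalerA mulrAC mulVf ?mul1r //.
    exact/natr_neq0/fact_gt0.
  apply: fword_perm; rewrite /w; under eq_map do rewrite addr0.
  rewrite -[X in perm_eq _ X](mkseq_nth 0) su /mkseq -val_enum_ord.
  rewrite -[X in perm_eq _ X]map_comp (map_comp (fun i : 'I_n => nth 0 u.2 i) t).
  exact: (perm_map (fun i : 'I_n => nth 0 u.2 i) (perm_enum_perm t)).
exists G; split; last first.
- move=> j jd; rewrite G0 big_seq; apply: big1 => u /hts[_ eu].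
  by rewrite fword_neq ?scaler0 // eu eq_sym.
- by rewrite G0.
split.
- move=> j e t; congr (_ *: _); apply: eq_bigr => u _; congr (_ *: _).
  rewrite (reindex_inj (mulgI t)); apply: eq_bigr => s _; apply: fword_perm.
  rewrite /w; under eq_map do rewrite permM.
  rewrite (map_comp (fun i => nth 0 u.2 (s i) + e i) t); apply: perm_map.
  exact: perm_enum_perm.
- move=> j j' e; rewrite actZr -scaler_sumr scalerA mulrC -scalerA; congr (_ *: _).
  rewrite exchange_big act_sumr scaler_sumr; apply: eq_bigr => u _ /=.
  rewrite -scaler_sumr actZr scalerA mulrC -scalerA; congr (_ *: _).
  rewrite exchange_big act_sumr scaler_sumr; apply: eq_bigr => t _ /=.
  rewrite fword_H ?enum_uniq // big_enum; congr (_ *: _); apply: eq_bigr => i _.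
  rewrite (_ : w u.2 t (bump_at i (j' - j) e)
    = [seq bump_at i (j' - j) (fun i0 => u.2`_(t i0) + e i0) i0 | i0 <- enum 'I_n]) //.
  apply: eq_map => x; rewrite /bump_at.
  by case: eqP => // _; rewrite addrA.
Qed.

(* Symmetric functions are polynomials in power sums: if e' is e with one nonzero
   entry l replaced by 0, then h(l) maps G e' to a nonzero multiple of G e plus
   terms with smaller support. *)
Lemma family_closed n (G : forall j, ('I_n -> int) -> M0 k j) (P : submod (M0 k)) :
  sym_family G -> (forall j, P j (G j (fun _ => 0))) -> forall j e, P j (G j e).
Proof.
move=> [Gsym GH] P0 j e.
have [N] := ubnP #|[set i | e i != 0]|; elim: N e j => // N IH e j.
have [h _|[i0]] := set_0Vmem [set i | e i != 0].
  have -> : e = fun _ => 0; last exact: P0.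
  apply: funext => i; have : i \notin [set i | e i != 0] by rewrite h inE.
  by rewrite inE negbK => /eqP.
rewrite inE => ei0; rewrite ltnS => leN.
pose e' i := if i == i0 then 0 else e i.
have se' : [set i | e' i != 0] \proper [set i | e i != 0].
  apply/properP; split; last by exists i0; rewrite !inE // /e' eqxx eqxx.
  by apply/fintype.subsetP => i; rewrite !inE /e'; case: ifP => _ //; rewrite eqxx.
have Pe' j' : P j' (G j' e') by apply: IH; apply: leq_trans (proper_card se') leN.
(* For these i, bumping e' at i gives e up to a transposition; for the others the support is a
   proper part of that of e. *)
pose B := [pred i | (i == i0) || (e i == 0)].
have bumpE i : bump_at i (j - (j - e i0)) e' = if i \in B then e \o tperm i i0
    else bump_at i (e i0) e'.
  have -> : j - (j - e i0) = e i0 by ring.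
  case: ifP => // /orP hB; apply: funext => x; rewrite /bump_at /e' /=.
  have [->|xi] := eqVneq x i.
    rewrite tpermL; case: eqP => [_|/eqP ii0]; first by rewrite add0r.
    by case: hB => [|/eqP ->]; [rewrite (negbTE ii0) | rewrite add0r].
  have [xi0|xi0] := eqVneq x i0; last by rewrite tpermD // eq_sym.
  rewrite xi0 tpermR; case: hB => /eqP // ii0.
  by rewrite xi0 ii0 eqxx in xi.
have : P j (\sum_i G j (bump_at i (j - (j - e i0)) e')).
  have -> : \sum_i G j (bump_at i (j - (j - e i0)) e')
      = (- 2%:R)^-1 *: act H j (G (j - e i0) e').
    by rewrite GH scalerA mulVf ?scale1r // oppr_eq0 natr_neq0.
  exact/smemZ/smem_act.
rewrite (bigID (mem B)) /= (eq_bigr (fun _ => G j e)) => [|i iB]; last first.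
  by rewrite bumpE iB Gsym.
rewrite sumr_const => PB.
have {}PB : P j (G j e *+ #|B|).
  rewrite -[G j e *+ _](addrK (\sum_(i | i \notin B) G j (bump_at i (j - (j - e i0)) e'))).
  apply: submodB PB _; apply: submod_sum => i iB; rewrite bumpE (negbTE iB).
  apply: IH; apply: leq_trans leN; apply: proper_card.
  move: iB; rewrite !inE negb_or => /andP[ii0 ei].
  apply/properP; split; last first.
    by exists i0; rewrite !inE // /bump_at /e' [i0 == i]eq_sym (negbTE ii0) !eqxx.
  apply/fintype.subsetP => x; rewrite !inE /bump_at /e'.
  have [->|_] := eqVneq x i; first by rewrite ei.
  by case: ifP => _ //; rewrite eqxx.
have B0 : (0 < #|B|)%N by apply/card_gt0P; exists i0; rewrite inE eqxx.
have := smemZ (#|B|%:R)^-1 PB.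
by rewrite -scaler_nat scalerA mulVf ?scale1r // natr_neq0.
Qed.
End Families.

(** * Linear extension from monomials *)

Section MonomialExtension.
Variables (k : fieldType) (n : nat) (V : lmodType k).
Implicit Type f : 'X_{1..n} -> V.

Definition mext f (p : {mpoly k[n]}) : V := \sum_(m <- msupp p) p@_m *: f m.

Lemma mextE f p (s : seq 'X_{1..n}) : uniq s -> {subset msupp p <= s} ->
  mext f p = \sum_(m <- s) p@_m *: f m.
Proof.
move=> us ps; rewrite [RHS](bigID (mem (msupp p))) /= [X in _ + X]big1 ?addr0.
  rewrite -big_filter; apply: perm_big; apply: uniq_perm.
  - exact: msupp_uniq.
  - exact: filter_uniq.
  - by move=> m; rewrite mem_filter; case: (boolP (m \in msupp p)) => // /ps ->.
by move=> m /memN_msupp_eq0 ->; rewrite scale0r.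
Qed.

Lemma mext_lin f : linear (mext f).
Proof.
move=> a p q; pose s := undup (msupp p ++ msupp q ++ msupp (a *: p + q)).
have us : uniq s := undup_uniq _.
have sub (t : seq 'X_{1..n}) : t \in [:: msupp p; msupp q; msupp (a *: p + q)] ->
    {subset t <= s}.
  rewrite !inE => /or3P[] /eqP -> m hm; rewrite mem_undup !mem_cat hm ?orbT //.
rewrite !(mextE _ us); try by apply: sub; rewrite !inE eqxx ?orbT.
rewrite scaler_sumr -big_split; apply: eq_bigr => m _ /=.
by rewrite mcoeffD mcoeffZ scalerDl scalerA.
Qed.

Lemma mext0 f : mext f 0 = 0.
Proof. by rewrite /mext msupp0 big_nil. Qed.

Lemma mextD f p q : mext f (p + q) = mext f p + mext f q.
Proof. by have := mext_lin f 1 p q; rewrite !scale1r. Qed.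

Lemma mextZ f a p : mext f (a *: p) = a *: mext f p.
Proof. by have := mext_lin f a p 0; rewrite mext0 !addr0. Qed.

Lemma mext_sum f I (r : seq I) (u : I -> {mpoly k[n]}) :
  mext f (\sum_(i <- r) u i) = \sum_(i <- r) mext f (u i).
Proof. by elim/big_rec2: _ => [|i x y _ <-]; rewrite ?mext0 ?mextD. Qed.

Lemma mextX f m : mext f 'X_[m] = f m.
Proof. by rewrite /mext msuppX big_seq1 mcoeffX eqxx scale1r. Qed.

Lemma mext_mulX f p m : mext f (p * 'X_[m]) = mext (fun m' => f (m' + m)%MM) p.
Proof.
rewrite [p in LHS]mpolyE mulr_suml mext_sum; apply: eq_bigr => m' _.
by rewrite -scalerAl -mpolyXD mextZ mextX.
Qed.

End MonomialExtension.

Section PartTwo.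
Local Arguments gcar : simpl never.
Local Arguments act : simpl never.
Variable k : fieldType.
Hypothesis char0 : [pchar k] =i pred0.
Hypothesis kclosed : GRing.closed_field_axiom k.
Variable n : nat.

Section Twist.
Variable G : forall j, ('I_n -> int) -> M0 k j.
Hypothesis Gfam : sym_family G.

(* The family multiplied by the Laurent polynomial (x_1 ... x_n)^-b p(x). *)
Definition twist (p : {mpoly k[n]}) (b : int) j (e : 'I_n -> int) : M0 k j :=
  mext (fun m => G j (fun i => e i - b + (m i)%:Z)) p.

Lemma twist_H p b j j' e :
  act H j' (twist p b j e) = - 2%:R *: \sum_i twist p b j' (bump_at i (j' - j) e).
Proof.
rewrite /twist /mext act_sumr exchange_big scaler_sumr /=; apply: eq_bigr => m _.
rewrite actZr (fam_H Gfam) -scaler_sumr !scalerA mulrC; congr (_ *: _).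
apply: eq_bigr => i _; congr (G _ _); apply: funext => x; rewrite /bump_at.
by case: eqP => // _; ring.
Qed.

Lemma twist_mulX p b m j e :
  twist (p * 'X_[m]) b j e = twist p b j (fun i => e i + (m i)%:Z).
Proof.
rewrite /twist mext_mulX; congr mext; apply: funext => m'; congr (G _ _).
by apply: funext => i; rewrite mnmDE PoszD; ring.
Qed.

(** The same Laurent polynomial with a larger denominator; used to reach common denominators. *)
Lemma twist_shift p (b : int) (r : nat) j e :
  twist (p * (\prod_i 'X_i) ^+ r) (b + r%:Z) j e = twist p b j e.
Proof.
have -> : (\prod_(i < n) 'X_i) ^+ r = 'X_[[multinom r | _ < n]] :> {mpoly k[n]}.
  by rewrite mpolyXE_id -prodrXl; apply: eq_bigr => i _; rewrite mnmE.
rewrite twist_mulX /twist; congr mext; apply: funext => m; congr (G _ _).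
by apply: funext => i; rewrite mnmE; ring.
Qed.

(* The exponent of (x_1 ... x_n)^|l| x_i^l. *)
Definition bmono (i : 'I_n) (l : int) : 'X_{1..n} :=
  [multinom (if x == i then absz (l + (absz l)%:Z)%R else absz l) | x < n].

Lemma addz_absz_ge0 (l : int) : 0 <= l + (absz l)%:Z.
Proof. by rewrite abszE addrC -[l in _ + l]opprK subr_ge0 -normrN ler_norm. Qed.

(** Multiplication by -2 times the l-th power sum, with denominator (x_1 ... x_n)^|l|, is the action
    of h(l). *)
Lemma twist_power_sum p b l j0 j1 e : j1 - j0 = l ->
  twist (- 2%:R *: (p * \sum_i 'X_[bmono i l])) (b + (absz l)%:Z) j1 e
  = act H j1 (twist p b j0 e).
Proof.
move=> jl; rewrite twist_H jl; rewrite {1}/twist mextZ mulr_sumr mext_sum.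
congr (_ *: _); apply: eq_bigr => i _; rewrite mext_mulX /twist; congr mext.
apply: funext => m; congr (G _ _); apply: funext => x.
rewrite mnmDE mnmE /bump_at; case: eqP => _; last by rewrite PoszD; ring.
by rewrite PoszD (gez0_abs (addz_absz_ge0 l)); ring.
Qed.


Lemma twist1 j e : twist 1 0 j e = G j e.
Proof.
rewrite /twist -mpolyX0 mextX; congr (G _ _); apply: funext => i.
by rewrite mnm0E subr0 addr0.
Qed.

Lemma twistD p q b j e : twist (p + q) b j e = twist p b j e + twist q b j e.
Proof. exact: mextD. Qed.

Lemma twistZ c p b j e : twist (c *: p) b j e = c *: twist p b j e.
Proof. exact: mextZ. Qed.

Lemma twist0 b j e : twist 0 b j e = 0.
Proof. exact: mext0. Qed.

Definition twist_symm p b :=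
  forall j e (t : 'S_n), twist p b j (e \o t) = twist p b j e.

Lemma twist_family p b : twist_symm p b -> sym_family (twist p b).
Proof. by move=> h; split=> // j j' e; apply: twist_H. Qed.

Section Annihilator.
Variable P : submod (M0 k).

Definition annih (p : {mpoly k[n]}) : Prop := forall j e, P j (twist p 0 j e).

(** Multiplication by a monomial only shifts e, and e is arbitrary. *)
Lemma annih_ideal : is_ideal annih.
Proof.
split.
- by move=> j e; rewrite /twist mext0; apply: smem0.
- by move=> p q hp hq j e; rewrite /twist mextD; apply: smemD; [apply: hp | apply: hq].
- move=> a p hp j e; rewrite [a]mpolyE mulr_suml.
  rewrite /twist mext_sum; apply: submod_sum => m _.
  rewrite -scalerAl mulrC mextZ; apply: smemZ.
  by have := hp j (fun i => e i + (m i)%:Z); rewrite -twist_mulX.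
Qed.

(** The exponents e may be negative, so the power can be cancelled by taking e = -r. *)
Lemma annih_mono d r : ~ P d (G d (fun _ => 0)) -> ~ annih ((\prod_i 'X_i) ^+ r).
Proof.
move=> PG h; apply: PG; have := h d (fun _ => - r%:Z).
have := twist_shift 1 (- r%:Z) r d (fun _ => - r%:Z); rewrite mul1r addNr => ->.
rewrite /twist -mpolyX0 mextX; congr (P d (G d _)); apply: funext => i.
by rewrite mnm0E; ring.
Qed.

(** A symmetric twist is itself a symmetric family, to which [family_closed] applies; shifting e by
    b removes the denominator. *)
Lemma twist_annih p b : twist_symm p b -> (forall j, P j (twist p b j (fun _ => 0))) ->
  annih p.
Proof.
move=> hs h0 j e; have := family_closed char0 (twist_family hs) h0 j (fun i => e i + b).
congr (P _ _); rewrite /twist; congr mext; apply: funext => m; congr (G _ _).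
by apply: funext => i; ring.
Qed.

End Annihilator.
End Twist.

Lemma meval_mono (a : 'I_n -> k) (m : 'X_{1..n}) :
  ('X_[m] : {mpoly k[n]}).@[a] = \prod_i a i ^+ m i.
Proof. by rewrite /meval mmapX. Qed.

Lemma meval_prodX (a : 'I_n -> k) :
  (\prod_i 'X_i : {mpoly k[n]}).@[a] = \prod_i a i.
Proof. by rewrite rmorph_prod; apply: eq_bigr => i _; rewrite /= mevalXU. Qed.

Lemma meval_bmono (a : 'I_n -> k) i l : (forall i, a i != 0) ->
  ('X_[bmono i l] : {mpoly k[n]}).@[a] = (\prod_i a i) ^+ absz l * a i ^ l.
Proof.
move=> a0; rewrite meval_mono [X in X ^+ _](bigD1 i) //= (bigD1 i) //= mnmE eqxx.
rewrite exprMn -prodrXl mulrAC; congr (_ * _); last first.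
  by apply: eq_bigr => x /negbTE xi; rewrite mnmE xi.
rewrite [LHS](_ : _ = a i ^ (l + (absz l)%:Z)); last first.
  by rewrite -[in RHS](gez0_abs (addz_absz_ge0 l)).
by rewrite expfzDr // mulrC.
Qed.

Section Core.
Variables (N P : submod (M0 k)).
Hypothesis Qirr : irreducible (subquot N P).
Variables (d : int) (m : M0 k d).
Hypotheses (levm : lev n m) (Nm : N d m) (nPm : ~ P d m).
Hypothesis Em : forall j, P j (act E j m).

Lemma subquot_pi_irr i (u u' : M0 k i) (Nu : N i u) (Nu' : N i u') :
  u = u' -> subquot_pi P Nu = subquot_pi P Nu'.
Proof. by move=> e; apply/subquot_pi_eq; rewrite e subrr; apply: smem0. Qed.

Theorem subquotient_Lphi : exists phi : int -> k, Exp phi /\ iso (subquot N P) (Lphi phi).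
Proof.
have [G [Gfam Gd Gj]] := exists_family char0 levm.
have idJ := annih_ideal G P.
have [|a [a0 aJ]] := torus_nullstellensatz char0 kclosed idJ.
  by move=> r; apply: (annih_mono (d := d)); rewrite Gd.
pose phi l := - 2%:R * \sum_(i < n) a i ^ l.
have phiE : Exp phi by exists n, a.
exists phi; split=> //.
(* The shift puts the top vector 1 in the degree d of v. *)
pose L := shift (- d) (Lphi phi).
have Lirr : irreducible L.
  exact: (iso_irreducible (shift_iso _ _) (Lphi_irreducible char0 phiE)).
have dd : d - d = 0 by rewrite subrr.
pose y : L d := Lpi (ind_in (Wone phi dd)).
have y0 : y <> 0 := Lpi_top_inj char0 phiE (e := dd).
have yT : Ltop (i := d - d) 1 y := Ltop_one phi dd.
pose v : subquot N P d := subquot_pi P Nm.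
pose z0 : prodg (subquot N P) L d := (v, y).
pose e0 : 'I_n -> int := fun _ => 0.
pose A := \prod_i a i.
have A0 : A != 0 by rewrite prodf_seq_neq0; apply/allP => i _ /=.
(* A symmetric Laurent polynomial p / (x_1 ... x_n)^b gives the first component when applied to m,
   and the second when evaluated at a. Homogeneity is recorded because membership in the annihilator
   concerns all degrees. *)
pose V j (z : prodg (subquot N P) L j) := exists (p : {mpoly k[n]}) (b : nat),
  [/\ twist_symm G p b%:Z, forall j', j' != j -> twist G p b%:Z j' e0 = 0,
      exists Nx : N j (twist G p b%:Z j e0), z.1 = subquot_pi P Nx &
      Ltop (i := j - d) (p.@[a] / A ^+ b) z.2].
have hV j z : hgen z0 z -> V j z.
  elim=> {j z}.
  - exists 1, 0%N; split.
    + by move=> j e t; rewrite !twist1 (fam_sym Gfam).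
    + by move=> j jd; rewrite twist1 Gj.
    + have Nx : N d (twist G 1 0 d e0) by rewrite twist1 Gd.
      by exists Nx; apply: subquot_pi_irr; rewrite twist1 Gd.
    + by rewrite meval1 expr0 divr1.
  - move=> i j [u l] _ [p [b [sp hp [Nx /= eu] hl]]].
    exists (- 2%:R *: (p * \sum_x 'X_[bmono x (j - i)])), (b + absz (j - i))%N.
    rewrite PoszD; have tw j1 e := twist_power_sum Gfam p b e (subKr j1 (j - i)).
    split.
    + by move=> j1 e t; rewrite !tw sp.
    + move=> j1 hj1; rewrite tw hp ?act0r //; apply: contra hj1 => /eqP h.
      by rewrite -(subrK (j - i) j1) h addrC subrK.
    + have eN := twist_power_sum Gfam p b e0 (erefl (j - i)).
      have Nx' : N j (twist G (- 2%:R *: (p * \sum_x 'X_[bmono x (j - i)]))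
          (b%:Z + (absz (j - i))%:Z) j e0) by rewrite eN; apply: smem_act.
      exists Nx'; rewrite eu; transitivity (subquot_pi P (smem_act H j Nx)).
        exact: (subquot_actE P Nx).
      by apply: subquot_pi_irr; rewrite eN.
    + have := Ltop_act (j - d) hl.
      have -> : j - d - (i - d) = j - i by ring.
      suff -> : phi (j - i) * (p.@[a] / A ^+ b)
          = (- 2%:R *: (p * \sum_x 'X_[bmono x (j - i)])).@[a] / A ^+ (b + absz (j - i)).
        by [].
      rewrite mevalZ mevalM raddf_sum /=.
      rewrite (eq_bigr (fun x => A ^+ absz (j - i) * a x ^ (j - i))) => [|x _]; last first.
        by rewrite meval_bmono.
      rewrite -mulr_sumr exprD invfM /phi; move: (expf_neq0 (absz (j - i)) A0) => At0.
      by field; rewrite At0 expf_neq0.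
  - move=> j; exists 0, 0%N; split.
    + by move=> j1 e t; rewrite !twist0.
    + by move=> j1 _; rewrite twist0.
    + have Nx : N j (twist G 0 0 j e0) by rewrite twist0; apply: smem0.
      exists Nx; transitivity (subquot_pi P (smem0 N j)) => //.
      by apply: subquot_pi_irr; rewrite twist0.
    + by rewrite meval0 mul0r; apply: Ltop_0.
  - move=> j c [u l] [u' l'] _ [p [b [sp hp [Nx /= eu] hl]]] _.
    move=> [p' [b' [sp' hp' [Nx' /= eu'] hl']]].
    (* The numerator over the common denominator of exponent b + b'. *)
    pose q := c *: (p * (\prod_x 'X_x) ^+ b') + p' * (\prod_x 'X_x) ^+ b.
    have tq j1 e : twist G q (b + b')%N%:Z j1 e
        = c *: twist G p b j1 e + twist G p' b' j1 e.
      rewrite /q twistD twistZ PoszD twist_shift.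
      by rewrite [X in twist G (p' * _) X]addrC twist_shift.
    exists q, (b + b')%N; split.
    + by move=> j1 e t; rewrite !tq sp sp'.
    + by move=> j1 hj1; rewrite tq hp // hp' // scaler0 addr0.
    + have Nq : N j (twist G q (b + b')%N%:Z j e0).
        by rewrite tq; apply: smemD => //; apply: smemZ.
      have Nq' : N j (c *: twist G p b j e0 + twist G p' b' j e0).
        by apply: smemD => //; apply: smemZ.
      exists Nq; rewrite eu eu'; transitivity (subquot_pi P Nq').
        exact/esym/(subquot_pi_lin P Nx Nx' Nq').
      by apply: subquot_pi_irr; rewrite tq.
    + have := Ltop_lin c hl hl'.
      suff -> : c * (p.@[a] / A ^+ b) + p'.@[a] / A ^+ b' = q.@[a] / A ^+ (b + b') by [].
      rewrite /q mevalD mevalZ !mevalM !rmorphXn /= meval_prodX -/A exprD.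
      by field; rewrite !expf_neq0.
have [f [flin fbij fact]] : exists f : forall i, subquot N P i -> L i,
   [/\ forall i, linear (f i), forall i, bijective (f i) &
       forall x i j u, f j (act x j u) = act x j (f i u)].
  apply: (goursat_iso (v := v) (y := y)) => //.
    by move=> v0; apply: nPm; rewrite -[m]subr0; apply/(subquot_pi_eq P Nm (smem0 N d)).
  move=> Xy.
  have : hgen z0 ((0, y) : prodg (subquot N P) L d).
    apply: (gen_top char0 (c := phi 0)) Xy _.
    - move=> j; rewrite /z0 prodg_act; congr (_, _).
        transitivity (subquot_pi P (smem_act E j Nm)); first exact: (subquot_actE P Nm).
        transitivity (subquot_pi P (smem0 N j)) => //.
        by apply/subquot_pi_eq; rewrite subr0.
      exact: (Ltop_E _ yT).
    - rewrite /z0 prodg_act prodgZ; congr (_, _); last exact: (Ltop_H yT).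
      transitivity (subquot_pi P (smem_act H d Nm)); first exact: (subquot_actE P Nm).
      have Nz : N d (phi 0 *: m + 0).
        by apply: smemD; [apply: smemZ | apply: smem0].
      transitivity (subquot_pi P Nz); last first.
        by rewrite (subquot_pi_lin P Nm (smem0 N d) Nz) [X in _ + X](_ : _ = 0) ?addr0.
      (* Both v and y have h(0)-weight phi(0) = -2n. *)
      have mH : act H d m = (0 - n.*2%:R) *: m.
        by apply: lev_h0 levm => i w; rewrite scale0r.
      apply: subquot_pi_irr; rewrite addr0 mH.
      congr (_ *: _); rewrite /phi (eq_bigr (fun _ => 1)) // sumr_const card_ord.
      by rewrite sub0r -mul2n natrM mulNr.
    - rewrite prodg_act prodgZ act0r scaler0; congr (_, _); exact: (Ltop_H yT).
  (* The first component being zero, p annihilates the family modulo P, so p(a) = 0 and y = 0. *)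
  move=> /hV[p [b [sp hp [Nx /= e] hy]]].
  apply: y0; apply: (Ltop_eq0 (i := d - d)).
  suff pa : p.@[a] = 0 by move: hy; rewrite pa mul0r.
  apply: aJ; apply: (twist_annih Gfam sp) => j.
  have [->|jd] := eqVneq j d; last by rewrite hp //; apply: smem0.
  have := (subquot_pi_eq P (smem0 N d) Nx).1 e.
  by rewrite sub0r => /(smemZ (-1)); rewrite scaleN1r opprK.
by exists (- d), f.
Qed.

End Core.
End PartTwo.

(** Separation of weights puts the level components of an element of N in N, so some vector of pure
    level is in N but not in P. E lowers the level, so it sends one of least level into P. *)
Lemma min_level (k : fieldType) (N P : submod (M0 k)) :
  [pchar k] =i pred0 -> ~ sub_le N P ->
  exists n d (m : M0 k d),
    [/\ lev n m, N d m, ~ P d m & forall j, P j (act E j m)].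
Proof.
move=> char0 NP.
have h0 i (w : triv k i) : hact i w = 0 *: w by rewrite scale0r.
pose bad n := exists d (m : M0 k d), [/\ lev n m, N d m & ~ P d m].
have [n bn] : exists n, bad n.
  apply: contrapT => nb; apply: NP => i v Nv.
  have [u [hu [m0 hm0]]] := ind_decomposes v.
  have Nu := lev_sep char0 h0 (N := N) (m := m0) hu.
  rewrite -(hm0 m0) // in Nu.
  rewrite (hm0 m0) //; apply: submod_sum => r _; apply: contrapT => Pu.
  by apply: nb; exists r, i, (u r); split=> //; apply: Nu.
have ex : exists r, `[< bad r >] by exists n; apply/asboolP.
case: (ex_minnP ex) => r /asboolP[d [m [lm Nm Pm]]] rmin.
exists r, d, m; split=> // j.
have := lev_E j lm; case: r lm rmin => [|r] lm rmin; first by move=> ->; apply: smem0.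
move=> lE; apply: contrapT => PE.
have : `[< bad r >] by apply/asboolP; exists j, (act E j m); split=> //; apply: smem_act.
by move/rmin; rewrite ltnn.
Qed.

Theorem theorem32 (k : fieldType) (char0 : [pchar k] =i pred0) :
  (forall phi : int -> k,
     Exp phi -> irreducible (Lphi phi) /\ subquotient (Lphi phi) (M0 k)) /\
  (GRing.closed_field_axiom k ->
   forall S : gmod k, irreducible S -> subquotient S (M0 k) ->
     exists phi : int -> k, Exp phi /\ iso S (Lphi phi)).
Proof.
split=> [phi phiE|kclosed S Sirr [N [P [PN SQ]]]].
  split; first exact: Lphi_irreducible.
  have [n [a [a0 aphi]]] := phiE; exact: (Lphi_subquotient char0 a0 aphi).
have Qirr := iso_irreducible SQ Sirr.
have [|n [d [m [lm Nm Pm Em]]]] := @min_level _ N P char0.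
  move=> NP; have [[i [q q0]] _] := Qirr; apply: q0.
  have [v [Nv ->]] := subquot_piP q.
  transitivity (subquot_pi P (smem0 N i)) => //.
  by apply/subquot_pi_eq; rewrite subr0; apply: NP.
have [phi [phiE QL]] := subquotient_Lphi char0 kclosed Qirr lm Nm Pm Em.
by exists phi; split=> //; apply: iso_trans SQ QL.
Qed.
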